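(* Let $m\ge 3$ be odd. There exists a continuous function $g:\partial\mathbb{B}\to\mathbb{R}_{0,m}$, not of class $C^1(\partial\mathbb{B})$, for which the Dirichlet problem $$\partial_{\underline{x}} f\,\partial_{\underline{x}}=0\ \text{ in }\mathbb{B},\qquad f=g\ \text{ on }\partial\mathbb{B}$$ has no solution $f\in C^2(\mathbb{B})\cap C(\overline{\mathbb{B}})$ with values in $\mathbb{R}_{0,m}$.
   Context: $\mathbb{R}_{0,m}$ is the real associative Clifford algebra generated by the orthonormal basis $e_1,\dots,e_m$ of $\mathbb{R}^m$ with $e_i^2=-1$, $e_ie_j=-e_je_i$ for $i\ne j$. The Dirac operator is $\partial_{\underline{x}}=\sum_{i=1}^m e_i\partial_{x_i}$, acting from the left or right, so $\partial_{\underline{x}} f\,\partial_{\underline{x}}=\sum_{i,j=1}^m e_i(\partial_{x_i}\partial_{x_j}f)e_j$. $\mathbb{B}$ is the open unit ball of $\mathbb{R}^m$ centered at $0$. Continuity and differentiability of $\mathbb{R}_{0,m}$-valued functions are understood componentwise. *)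

(* Defs.v *)
From HB Require Import structures.
From mathcomp Require Import all_boot all_order all_algebra.
From mathcomp Require Import all_classical all_reals all_analysis.
From mathcomp Require Import ring.

Set Implicit Arguments.
Unset Strict Implicit.
Unset Printing Implicit Defensive.

Import Order.TTheory GRing.Theory Num.Theory.
Import numFieldNormedType.Exports.
Local Open Scope classical_set_scope.
Local Open Scope ring_scope.

Section SymmetricDifference.
Context {T : finType}.
Implicit Types A B C : {set T}.

Definition symdiff A B : {set T} := [set x | (x \in A) (+) (x \in B)]%SET.

Lemma in_symdiff A B x : (x \in symdiff A B) = (x \in A) (+) (x \in B).
Proof. by rewrite inE. Qed.

Lemma symdiffA : associative symdiff.
Proof. by move=> A B C; apply/setP => x; rewrite !in_symdiff addbA. Qed.

Lemma symdiffC : commutative symdiff.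
Proof. by move=> A B; apply/setP => x; rewrite !in_symdiff addbC. Qed.

Lemma symdiffK A : involutive (symdiff A).
Proof. by move=> B; apply/setP => x; rewrite !in_symdiff addKb. Qed.

Lemma symdiff0 A : symdiff A finset.set0 = A.
Proof. by apply/setP => x; rewrite in_symdiff finset.in_set0 addbF. Qed.

Lemma sym0diff A : symdiff finset.set0 A = A.
Proof. by rewrite symdiffC symdiff0. Qed.

Lemma symdiffv A : symdiff A A = finset.set0.
Proof. by apply/setP => x; rewrite in_symdiff finset.in_set0 addbb. Qed.

End SymmetricDifference.

(* The Clifford algebra R_{0,m}, as the space of coordinates on the basis
   e_A = e_{i_1} ... e_{i_k}, A = {i_1 < ... < i_k} a subset of 'I_m.
   An alias is needed because {ffun _ -> R} already carries the pointwise
   product. *)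
Definition clifford (R : nzRingType) (m : nat) : Type := {ffun {set 'I_m} -> R}.

HB.instance Definition _ (R : nzRingType) m := GRing.Zmodule.on (clifford R m).

Section CliffordAlgebra.
Variables (R : comNzRingType) (m : nat).
Implicit Types (A B C D : {set 'I_m}) (a b c : clifford R m).

(* e_A e_B = cliff_sign A B e_{A symdiff B}: when the generators of A are moved
   past those of B, each pair (i, j) in A x B contributes e_i e_j = - e_j e_i
   if j < i, and e_i ^ 2 = -1 if j = i. *)
Definition cliff_sign A B : R :=
  \prod_(i in A) \prod_(j in B | (j <= i)%N) (-1).

Definition cliff_scale (k : R) a : clifford R m := [ffun A => k * a A].

Definition cliff_one : clifford R m := [ffun A => (A == finset.set0)%:R].

(* The e_A contributing to e_C in the product are paired with e_B for
   B = A symdiff C. *)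
Definition cliff_mul a b : clifford R m :=
  [ffun C => \sum_A cliff_sign A (symdiff A C) * a A * b (symdiff A C)].

Let sgn (p : bool) : R := if p then -1 else 1.

Let sgnD p q : sgn (p (+) q) = sgn p * sgn q.
Proof. by case: p q => -[]; rewrite /sgn /= ?mulN1r ?mul1r ?mulr1 ?opprK. Qed.

Let cliff_signE A B : cliff_sign A B =
  \prod_(i : 'I_m) \prod_(j : 'I_m | (j <= i)%N) sgn ((i \in A) && (j \in B)).
Proof.
rewrite /cliff_sign big_mkcond /=; apply: eq_bigr => i _.
case: ifP => iA /=; last by rewrite big1.
rewrite big_mkcondl /=; apply: eq_bigr => j _.
by rewrite /sgn; case: (j \in B).
Qed.

Lemma cliff_signDl A B C :
  cliff_sign (symdiff A B) C = cliff_sign A C * cliff_sign B C.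
Proof.
rewrite !cliff_signE -big_split; apply: eq_bigr => i _ /=.
rewrite -big_split; apply: eq_bigr => j _ /=.
by rewrite in_symdiff andb_addl sgnD.
Qed.

Lemma cliff_signDr A B C :
  cliff_sign A (symdiff B C) = cliff_sign A B * cliff_sign A C.
Proof.
rewrite !cliff_signE -big_split; apply: eq_bigr => i _ /=.
rewrite -big_split; apply: eq_bigr => j _ /=.
by rewrite in_symdiff andb_addr sgnD.
Qed.

Lemma cliff_sign0l A : cliff_sign finset.set0 A = 1.
Proof. by rewrite /cliff_sign big_set0. Qed.

Lemma cliff_sign0r A : cliff_sign A finset.set0 = 1.
Proof.
by rewrite /cliff_sign big1 // => i _; rewrite big_pred0 // => j; rewrite finset.in_set0.
Qed.

Lemma cliff_sign_sqr A B : cliff_sign A B * cliff_sign A B = 1.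
Proof. by rewrite -cliff_signDr symdiffv cliff_sign0r. Qed.

Fact cliff_mulA : associative cliff_mul.
Proof.
move=> a b c; apply/ffunP => D; rewrite !ffunE.
under [RHS]eq_bigr => C _ do rewrite ffunE mulr_sumr mulr_suml.
rewrite [RHS]exchange_big /=; apply: eq_bigr => A _.
rewrite ffunE mulr_sumr [LHS](reindex_inj (inv_inj (symdiffK A))) /=.
apply: eq_bigr => C _.
have -> : symdiff (symdiff A C) (symdiff A D) = symdiff C D.
  by rewrite (symdiffC A C) -symdiffA symdiffK.
rewrite !cliff_signDr !cliff_signDl.
by rewrite -[RHS]mul1r -(cliff_sign_sqr A D); ring.
Qed.

Fact cliff_mul1l : left_id cliff_one cliff_mul.
Proof.
move=> a; apply/ffunP => C; rewrite ffunE (bigD1 finset.set0) //= big1 => [|A A0].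
  by rewrite cliff_sign0l sym0diff ffunE eqxx !mul1r addr0.
by rewrite ffunE (negbTE A0) mulr0 mul0r.
Qed.

Fact cliff_mul1r : right_id cliff_one cliff_mul.
Proof.
move=> a; apply/ffunP => C; rewrite ffunE (bigD1 C) //= big1 => [|A AC].
  by rewrite symdiffv cliff_sign0r ffunE eqxx mul1r mulr1 addr0.
rewrite ffunE; case: eqP => [AC0|]; last by rewrite mulr0.
by rewrite -(symdiffK A C) AC0 symdiff0 eqxx in AC.
Qed.

Fact cliff_mulDl : left_distributive cliff_mul +%R.
Proof.
move=> a b c; apply/ffunP => C; rewrite !ffunE -big_split.
by apply: eq_bigr => A _; rewrite ffunE mulrDr mulrDl.
Qed.

Fact cliff_mulDr : right_distributive cliff_mul +%R.
Proof.
move=> a b c; apply/ffunP => C; rewrite !ffunE -big_split.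
by apply: eq_bigr => A _; rewrite ffunE mulrDr.
Qed.

Fact cliff_one_neq0 : cliff_one != 0.
Proof.
by apply/eqP => /ffunP/(_ finset.set0)/eqP; rewrite !ffunE eqxx oner_eq0.
Qed.

HB.instance Definition _ := GRing.Zmodule_isNzRing.Build (clifford R m)
  cliff_mulA cliff_mul1l cliff_mul1r cliff_mulDl cliff_mulDr cliff_one_neq0.

Fact cliff_scaleA (k l : R) a :
  cliff_scale k (cliff_scale l a) = cliff_scale (k * l) a.
Proof. by apply/ffunP => A; rewrite !ffunE mulrA. Qed.

Fact cliff_scale1 : left_id 1 cliff_scale.
Proof. by move=> a; apply/ffunP => A; rewrite !ffunE mul1r. Qed.

Fact cliff_scaleDr : right_distributive cliff_scale +%R.
Proof. by move=> k a b; apply/ffunP => A; rewrite !ffunE mulrDr. Qed.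

Fact cliff_scaleDl a : {morph cliff_scale^~ a : k l / k + l}.
Proof. by move=> k l; apply/ffunP => A; rewrite !ffunE mulrDl. Qed.

HB.instance Definition _ := GRing.Zmodule_isLmodule.Build R (clifford R m)
  cliff_scaleA cliff_scale1 cliff_scaleDr cliff_scaleDl.

Fact cliff_scaleAl (k : R) a b : k *: (a * b) = (k *: a) * b.
Proof.
apply/ffunP => C; rewrite !ffunE; rewrite mulr_sumr; apply: eq_bigr => A _.
by rewrite ffunE; ring.
Qed.

HB.instance Definition _ :=
  GRing.Lmodule_isLalgebra.Build R (clifford R m) cliff_scaleAl.

Fact cliff_scaleAr (k : R) a b : k *: (a * b) = a * (k *: b).
Proof.
apply/ffunP => C; rewrite !ffunE; rewrite mulr_sumr; apply: eq_bigr => A _.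
by rewrite ffunE; ring.
Qed.

HB.instance Definition _ :=
  GRing.Lalgebra_isAlgebra.Build R (clifford R m) cliff_scaleAr.

Definition cliff_blade A : clifford R m := [ffun B => (B == A)%:R].

Definition cliff_gen (i : 'I_m) : clifford R m := cliff_blade [set i]%SET.

Lemma cliff_coordE a : a = \sum_A a A *: cliff_blade A.
Proof.
apply/ffunP => B; rewrite sum_ffunE (bigD1 B) //= big1 => [|A AB].
  by rewrite !ffunE eqxx addr0 mulr1.
by rewrite !ffunE eq_sym (negbTE AB) mulr0.
Qed.

Lemma cliff_bladeM A B :
  cliff_blade A * cliff_blade B = cliff_sign A B *: cliff_blade (symdiff A B).
Proof.
apply/ffunP => C; rewrite !ffunE (bigD1 A) //= big1 => [|A' AA'].
  rewrite !ffunE eqxx mulr1 addr0.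
  have -> : (symdiff A C == B) = (C == symdiff A B).
    by apply/eqP/eqP => [<-|->]; rewrite symdiffK.
  by case: eqP => [->|_]; rewrite ?symdiffK ?mulr0.
by rewrite !ffunE (negbTE AA') mulr0 mul0r.
Qed.

Lemma cliff_gen_sqr i : cliff_gen i ^+ 2 = -1.
Proof.
rewrite expr2 cliff_bladeM symdiffv /cliff_sign big_set1.
rewrite (eq_bigl (pred1 i)) ?big_pred1_eq ?scaleN1r //.
by move=> j; rewrite finset.in_set1 /=; case: eqP => // ->; rewrite leqnn.
Qed.

Lemma cliff_gen_anticomm i j :
  i != j -> cliff_gen i * cliff_gen j = - (cliff_gen j * cliff_gen i).
Proof.
move=> ij; rewrite !cliff_bladeM symdiffC -scaleNr; congr (_ *: _).
have signE (k l : 'I_m) :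
    cliff_sign [set k]%SET [set l]%SET = if (l <= k)%N then -1 else 1.
  rewrite /cliff_sign big_set1 big_mkcondr /=.
  rewrite (eq_bigl (pred1 l)) ?big_pred1_eq // => h.
  by rewrite finset.in_set1.
rewrite !signE; have := ij; rewrite -val_eqE /= neq_ltn.
by case: ltngtP => //= _ _; rewrite opprK.
Qed.

Lemma cliff_bladeE A : cliff_blade A = \prod_(i <- enum A) cliff_gen i.
Proof.
have : sorted (fun i j : 'I_m => (i < j)%N) (enum A).
  rewrite {1}/enum_mem sorted_filter //; first by move=> x y z; apply: ltn_trans.
  rewrite -enumT -(@sorted_map _ _ val ltn) val_enum_ord.
  exact: iota_ltn_sorted.
rewrite -{2}(set_enum A); elim: (enum A) => [|i s IH] /= is_sorted.
  rewrite big_nil; apply/ffunP => B; rewrite !ffunE.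
  by congr (_ == _)%:R; apply/setP => j; rewrite !inE.
have i_lt : all (fun j : 'I_m => i < j)%N s.
  by apply: order_path_min is_sorted => x y z; apply: ltn_trans.
rewrite big_cons -IH ?(path_sorted is_sorted) // cliff_bladeM.
rewrite /cliff_sign big_set1 big_pred0 => [|j]; last first.
  rewrite inE; apply/negbTE/negP => /andP[js]; apply/negP.
  by rewrite -ltnNge (allP i_lt).
rewrite scale1r; congr cliff_blade; apply/setP => j; rewrite in_symdiff !inE.
case: eqP => // -> /=; apply/esym/negP => /(allP i_lt); rewrite ltnn //.
Qed.

End CliffordAlgebra.

Section UnitBall.
Variables (R : realType) (m : nat).
Implicit Types (U : set 'rV[R]_m) (x : 'rV[R]_m) (h : 'rV[R]_m -> R).

(* The library norm of 'rV[R]_m is the sup norm (with the same topology), so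
   the Euclidean balls are written out. *)
Definition unit_ball : set 'rV[R]_m := [set x | \sum_i x 0 i ^+ 2 < 1].

Definition unit_cball : set 'rV[R]_m := [set x | \sum_i x 0 i ^+ 2 <= 1].

Definition unit_sphere : set 'rV[R]_m := [set x | \sum_i x 0 i ^+ 2 = 1].

Definition partial (i : 'I_m) h : 'rV[R]_m -> R :=
  fun x => 'D_(delta_mx 0 i) h x.

(* h is of class C^k on U; meant for U open. *)
Fixpoint class_C (k : nat) U h : Prop :=
  (forall x, U x -> {for x, continuous h}) /\
  if k is k'.+1 then
    forall i, (forall x, U x -> derivable h x (delta_mx 0 i)) /\
              class_C k' U (partial i h)
  else True.

(* C^1 functions on the sphere: those which extend, locally around each point
   of the sphere, to a C^1 function on an open subset of R^m. *)
Definition sphere_C1 h : Prop :=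
  forall x, unit_sphere x ->
    exists U (H : 'rV[R]_m -> R),
      [/\ open U, U x, class_C 1 U H &
          forall y, U y -> unit_sphere y -> H y = h y].

End UnitBall.

Arguments unit_ball : clear implicits.
Arguments unit_cball : clear implicits.
Arguments unit_sphere : clear implicits.

Section CliffordAnalysis.
Variables (R : realType) (m : nat).
Implicit Types (f g : 'rV[R]_m -> clifford R m) (U : set 'rV[R]_m).

Definition cliff_coord (A : {set 'I_m}) f : 'rV[R]_m -> R := fun x => f x A.

Definition cliff_class_C (k : nat) U f : Prop :=
  forall A, class_C k U (cliff_coord A f).

Definition cliff_continuous_on U f : Prop :=
  forall A, {within U, continuous (cliff_coord A f)}.

Definition cliff_sphere_C1 f : Prop :=
  forall A, sphere_C1 (cliff_coord A f).

Definition cliff_partial (i : 'I_m) f : 'rV[R]_m -> clifford R m :=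
  fun x => [ffun A => partial i (cliff_coord A f) x].

Definition diracl f : 'rV[R]_m -> clifford R m :=
  fun x => \sum_i cliff_gen R i * cliff_partial i f x.

Definition diracr f : 'rV[R]_m -> clifford R m :=
  fun x => \sum_i cliff_partial i f x * cliff_gen R i.

Lemma cliff_coord_partial A i f :
  cliff_coord A (cliff_partial i f) = partial i (cliff_coord A f).
Proof. by apply/funext => y; rewrite /cliff_coord ffunE. Qed.

Let derive_bigsum (I : Type) (r : seq I) (h : I -> 'rV[R]_m -> R) x v :
  (forall i, derivable (h i) x v) ->
  derivable (fun y => \sum_(i <- r) h i y) x v /\
  'D_v (fun y => \sum_(i <- r) h i y) x = \sum_(i <- r) 'D_v (h i) x.
Proof.
move=> dh; elim: r => [|i r [IHd IHe]].
  have -> : (fun y => \sum_(i <- [::]) h i y) = cst 0.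
    by apply/funext => y; rewrite big_nil.
  by rewrite big_nil derive_cst; split => //; apply: derivable_cst.
have -> : (fun y => \sum_(j <- i :: r) h j y) =
    h i + (fun y => \sum_(j <- r) h j y).
  by apply/funext => y; rewrite big_cons.
by rewrite big_cons -IHe; split; [apply: derivableD | apply: deriveD].
Qed.

Lemma diraclrE U f x : cliff_class_C 2 U f -> U x ->
  diracl (diracr f) x =
  \sum_i \sum_j
    cliff_gen R i * cliff_partial i (cliff_partial j f) x * cliff_gen R j.
Proof.
move=> fC2 Ux; apply: eq_bigr => i _.
under [RHS]eq_bigr => j _ do rewrite -mulrA.
rewrite -mulr_sumr; congr (_ * _); apply/ffunP => C.
rewrite sum_ffunE ffunE /partial; set v := delta_mx 0 i.
have dp j A : derivable (cliff_coord A (cliff_partial j f)) x v.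
  have [_ /(_ j)[_ [_ /(_ i)[+ _]]]] := fC2 A.
  by rewrite cliff_coord_partial; apply.
pose k j A : R := cliff_sign R A (symdiff A C) * cliff_gen R j (symdiff A C).
pose h j A := k j A \*: cliff_coord A (cliff_partial j f).
have dh j A : derivable (h j A) x v by apply: derivableZ.
have -> : cliff_coord C (diracr f) = (fun y => \sum_j \sum_A h j A y).
  apply/funext => y; rewrite /cliff_coord sum_ffunE; apply: eq_bigr => j _.
  rewrite ffunE; apply: eq_bigr => A _.
  by rewrite /h /k /= /cliff_coord mulrAC.
have dhs j := derive_bigsum (index_enum _) (dh j).
rewrite (derive_bigsum _ (fun j => (dhs j).1)).2; apply: eq_bigr => j _.
rewrite (dhs j).2 ffunE; apply: eq_bigr => A _.
by rewrite deriveZ // ffunE mulrAC.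
Qed.

End CliffordAnalysis.

(* Main.v *)
Require Import Defs.
From mathcomp Require Import all_boot all_order all_algebra.
From mathcomp Require Import all_classical all_reals all_analysis.
From mathcomp Require Import complex ring lra zify.

Set Implicit Arguments.
Unset Strict Implicit.
Unset Printing Implicit Defensive.

Import Order.TTheory GRing.Theory Num.Theory.
Import numFieldNormedType.Exports.
Local Open Scope classical_set_scope.
Local Open Scope ring_scope.

(* Let u be the 1-vector part of a solution f, P_k = Re (x_0 + i x_1)^k and
   Q_k the gradient of P_k. Then L u = Delta u - 2 grad div u = 0, and
   L ((1 - |x|^2) Q_k) = (4 - 2 m) Q_k. If f = x a on the sphere, Green's formula
   turns this into
     (2 - m) \int_ball u . Q_k = k \int_sphere a P_k.
   Since |Q_k| = k rho^((k - 1) / 2) with rho = x_0^2 + x_1^2, and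
   \int_ball rho^((k - 1) / 2) is of the order of (1 / k) \int_sphere rho^k,
   a bounded u forces the coefficient of P_k in a to be O(1 / k). This fails for
   the continuous function a = sum_j 2^-j P_(2 * 4^j + 1).

   Integrals are replaced by means over finer and finer grids of [-1, 1]^m:
   [asym_npos h] and [asym_null h] stand for \int h <= 0 and \int h = 0. So that
   all the functions involved are supported in the open ball, 1 - |x|^2 is
   replaced by eta (1 - |x|^2), with eta of class C^2, zero up to d and affine
   from 3 d on. *)

(** What makes the argument work is that the factor [4 - 2 m] is free of k. On (1 - |x|^2) Q_k the
    Laplacian alone gives the factor -2 m - 4 (k - 1). Since div Q_k = 0 and x . Q_k = k P_k, the
    divergence of the field is -2 k P_k, so -2 grad div contributes + 4 k and the growth in k
    cancels. For the Laplacian alone the extra factor k would leave room for every bounded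
    coefficient.

    P_k involves two variables only, so that P_k^2 and its conjugate square add up to rho^k and
    every mean that occurs reduces to means of powers of rho. These are related through the
    divergences of three vector fields times a radial weight: x, its planar part and the planar
    rotation. No integral has to be evaluated. Odd degrees k = 2 l + 1 make |Q_k| / k the polynomial
    rho^l. *)

Section GridMean.
Variables (R : realType) (m : nat).
Implicit Types (f g h : 'rV[R]_m -> R) (x : 'rV[R]_m) (c d e t : R).

(** * Grid means and integration by parts on the grid *)

Definition grid_pt n (J : {ffun 'I_m -> 'I_n}) : 'rV[R]_m :=
  \row_i (2 * (J i)%:R / n%:R - 1).

(* The number of points per side is a multiple of [4 * m], so that the cube
   [[1/(2m), 1/m]^m] contains a fixed proportion of the grid. *)
Definition grid_side N := (4 * m * N.+1)%N.

Definition grid_mean N f : R :=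
  (grid_side N)%:R ^- m * \sum_(J : {ffun 'I_m -> 'I_(grid_side N)}) f (grid_pt J).

Definition asym_npos f :=
  forall e, 0 < e -> \forall N \near \oo, grid_mean N f <= e.

Definition asym_null f := asym_npos f /\ asym_npos (- f).

Lemma grid_meanD N f g : grid_mean N (f + g) = grid_mean N f + grid_mean N g.
Proof. by rewrite /grid_mean big_split mulrDr. Qed.

Lemma grid_meanZ N c f : grid_mean N (c \*o f) = c * grid_mean N f.
Proof. by rewrite /grid_mean -mulr_sumr mulrCA. Qed.

Lemma grid_pt_itv n (J : {ffun 'I_m -> 'I_n}) i : -1 <= grid_pt J 0 i <= 1.
Proof.
rewrite mxE; have n0 : 0 < n%:R :> R by rewrite ltr0n (leq_ltn_trans _ (ltn_ord (J i))).
have : 0 <= ((J i)%:R / n%:R : R) <= 1.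
  by rewrite divr_ge0 ?ler0n //= ler_pdivrMr // mul1r ler_nat ltnW.
by rewrite -mulrA; set q := (_ / _) => ?; lra.
Qed.

Lemma le_grid_mean N f g :
  (forall x, (forall i, -1 <= x 0 i <= 1) -> f x <= g x) ->
  grid_mean N f <= grid_mean N g.
Proof.
move=> fg; rewrite ler_wpM2l ?invr_ge0 ?exprn_ge0 ?ler0n //.
by apply: ler_sum => J _; apply: fg => i; apply: grid_pt_itv.
Qed.

Lemma grid_mean_cst N c : (0 < m)%N -> grid_mean N (fun=> c) = c.
Proof.
move=> m0; rewrite /grid_mean sumr_const card_ffun !card_ord -[c *+ _]mulr_natl.
rewrite natrX mulrA mulVf ?mul1r // expf_neq0 // pnatr_eq0 /grid_side.
by rewrite !muln_eq0 /=; case: m m0.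
Qed.

Lemma asym_npos_le f g :
  (forall x, (forall i, -1 <= x 0 i <= 1) -> f x <= g x) ->
  asym_npos g -> asym_npos f.
Proof.
move=> fg g0 e /g0; apply: filterS => N; apply: le_trans.
exact: le_grid_mean.
Qed.

Lemma asym_nposD f g : asym_npos f -> asym_npos g -> asym_npos (f + g).
Proof.
move=> f0 g0 e e0; have e2 : 0 < e / 2 by rewrite divr_gt0.
near=> N; rewrite grid_meanD [e]splitr lerD //; near: N; [exact: f0|exact: g0].
Unshelve. all: by end_near. Qed.

Lemma asym_npos0 : asym_npos 0.
Proof.
move=> e e0; near=> N; rewrite /grid_mean big1 // mulr0 ltW //.
Unshelve. all: by end_near. Qed.

Lemma asym_nposZ c f : 0 <= c -> asym_npos f -> asym_npos (c \*o f).
Proof.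
rewrite le_eqVlt => /predU1P[<- _|c0 f0 e e0].
  by apply: asym_npos_le asym_npos0 => x _; rewrite /= mul0r.
have /f0 : 0 < e / c by rewrite divr_gt0.
by apply: filterS => N; rewrite grid_meanZ ler_pdivlMr // mulrC.
Qed.

Lemma asym_null_ext f g :
  (forall x, (forall i, -1 <= x 0 i <= 1) -> f x = g x) ->
  asym_null g -> asym_null f.
Proof.
by move=> fg [g0 g1]; split; [apply: asym_npos_le g0|apply: asym_npos_le g1];
  move=> x xc /=; rewrite /= -?fg // !opprfctE fg.
Qed.

Lemma asym_nullD f g : asym_null f -> asym_null g -> asym_null (f + g).
Proof.
by move=> [? ?] [? ?]; split; rewrite ?opprD; apply: asym_nposD.
Qed.

Lemma asym_nullN f : asym_null f -> asym_null (- f).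
Proof. by move=> [? ?]; split; rewrite ?opprK. Qed.

Lemma asym_null0 : asym_null 0.
Proof. by split; rewrite ?oppr0; apply: asym_npos0. Qed.

Lemma asym_nullZ c f : asym_null f -> asym_null (c \*o f).
Proof.
move=> [f0 f1]; case: (leP 0 c) => [c0|/ltW c0].
  split; first exact: asym_nposZ.
  by apply: asym_npos_le (asym_nposZ c0 f1) => x _ /=; rewrite !opprfctE mulrN.
have c1 : 0 <= - c by rewrite oppr_ge0.
split.
  by apply: asym_npos_le (asym_nposZ c1 f1) => x _ /=; rewrite !opprfctE mulrNN.
by apply: asym_npos_le (asym_nposZ c1 f0) => x _ /=; rewrite !opprfctE mulNr.
Qed.

Lemma asym_null_sum (I : Type) (r : seq I) (P : pred I) (F : I -> 'rV[R]_m -> R) :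
  (forall i, P i -> asym_null (F i)) ->
  asym_null (fun x => \sum_(i <- r | P i) F i x).
Proof.
move=> F0; suff : asym_null (\sum_(i <- r | P i) F i).
  by apply: asym_null_ext => x _; rewrite fct_sumE.
by elim/big_ind: _ => //; [exact: asym_null0|exact: asym_nullD].
Qed.

(** The window is a block of [K ^ m] indices out of [(4 m K) ^ m], whence a bound independent of
    [N]. It supplies the positive quantity that the final upper bound contradicts. *)
Lemma grid_mean_window N f : (0 < m)%N ->
  (forall x, (forall i, -1 <= x 0 i <= 1) -> 0 <= f x) ->
  forall c, 0 <= c ->
  (forall x, (forall i, (2 * m)%:R^-1 <= x 0 i <= m%:R^-1) -> c <= f x) ->
  c / (4 * m)%:R ^+ m <= grid_mean N f.
Proof.
move=> m0 f0 c c0 fc; set K := N.+1; pose n := grid_side N.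
have nE : n%:R = (4 * m)%:R * K%:R :> R by rewrite -natrM.
(* Index [2 m K + K + k] has coordinate [(K + k) / (2 m K)], which stays in [[1/(2m), 1/m]] for
   [k < K]. *)
have shP (k : 'I_K) : (2 * m * K + K + k < n)%N.
  have := ltn_ord k; rewrite /n /grid_side -/K; move: m0.
  by move: (nat_of_ord k) => k'; nia.
pose sh k : 'I_n := Ordinal (shP k).
have sh_inj : injective sh.
  by move=> k l /(congr1 val) /= /addnI/val_inj.
pose W := [pred J : {ffun 'I_m -> 'I_n} | J \in ffun_on (mem (codom sh))].
have cW : #|W| = (K ^ m)%N.
  have -> : #|W| = #|ffun_on (mem (codom sh)) : {pred {ffun 'I_m -> 'I_n}}|.
    by apply: eq_card.
  by rewrite card_ffun_on card_codom // !card_ord.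
have W_le : c *+ (K ^ m) <= \sum_(J : {ffun 'I_m -> 'I_n}) f (grid_pt J).
  rewrite -cW -sumr_const big_mkcond ler_sum // => J _.
  case: ifP => [/ffun_onP JW|_]; last by apply: f0 => i; apply: grid_pt_itv.
  apply: fc => i; have /codomP[k Jk] := JW i; rewrite mxE Jk nE /=.
  have mR : 0 < m%:R :> R by rewrite ltr0n.
  have KR : 0 < K%:R :> R by rewrite ltr0n.
  have kK : (k%:R : R) <= K%:R by rewrite ler_nat ltnW.
  have -> : 2 * (2 * m * K + K + k)%:R / ((4 * m)%:R * K%:R) - 1 =
      (K%:R + k%:R) / (2 * m%:R * K%:R) :> R.
    by rewrite !natrD !natrM; field; rewrite !gt_eqF ?addr_gt0.
  set q := (_ + _) / _.
  have -> : (2 * m)%:R^-1 = q - k%:R / (2 * m%:R * K%:R) :> R.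
    by rewrite /q natrM; field; rewrite !gt_eqF.
  have -> : m%:R^-1 = q + (K%:R - k%:R) / (2 * m%:R * K%:R) :> R.
    by rewrite /q; field; rewrite !gt_eqF.
  by rewrite gerBl lerDl !divr_ge0 ?subr_ge0 ?mulr_ge0.
rewrite /grid_mean -/n nE exprMn invfM -mulrA mulrC ler_wpM2l ?invr_ge0 ?exprn_ge0 //.
by rewrite mulrC ler_pdivlMr ?exprn_gt0 ?ltr0n // -natrX mulr_natr.
Qed.

(** Stated on the restriction to a line, so that the one-variable product rule, chain rule and mean
    value theorem apply as they are. *)
Definition has_pd i h g :=
  forall x, is_derive (0 : R) (1 : R) (fun t => h (x + t *: delta_mx 0 i)) (g x).

Lemma is_derive_line i h (D : R) x t :
  is_derive (0 : R) (1 : R)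
    (fun s => h (x + t *: delta_mx 0 i + s *: delta_mx 0 i)) D ->
  is_derive t (1 : R) (fun t => h (x + t *: delta_mx 0 i)) D.
Proof.
move=> hD; set d : 'rV[R]_m := delta_mx 0 i.
have -> : (fun t' => h (x + t' *: d)) =
    (fun s => h (x + t *: d + s *: d)) \o (fun t' => t' - t).
  by apply/funext => t' /=; rewrite -addrA -scalerDl [t + _]addrC subrK.
rewrite -[D]mulr1; apply: is_derive1_comp; first by rewrite subrr.
by apply: is_derive_eq; rewrite subr0.
Qed.

(** Uniform continuity by compactness of the cube. Only [x] is confined to the cube: the shifted
    point may leave it through a face. *)
Lemma unif_shift g i e : continuous g -> 0 < e ->
  exists2 d, 0 < d & forall x t, (forall j, -1 <= x 0 j <= 1) ->
    0 <= t < d -> `|g (x + t *: delta_mx 0 i) - g x| <= e.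
Proof.
move=> gc e0; pose K := [set x : 'rV[R]_m | forall j, x 0 j \in `[-1, 1]].
have /compact_near_coveringP Kc : compact K.
  have := @rV_compact R m (fun=> `[-1, 1]%classic).
  by apply => _; apply: segment_compact.
pose P (t : R) x := `|g (x + t *: delta_mx 0 i) - g x| <= e.
have Px x : K x -> \forall x' \near x & t \near (0 : R), P t x'.
  move=> _; have e2 : 0 < e / 2 by rewrite divr_gt0.
  have ct : (fun z : 'rV[R]_m * R => z.1 + z.2 *: delta_mx 0 i) z @[z --> (x, 0)] -->
      x + 0 *: delta_mx 0 i.
    apply: cvgD; first exact: cvg_fst.
    by apply: cvgZr_tmp; exact: cvg_snd.
  rewrite scale0r addr0 in ct.
  have {}ct : g (z.1 + z.2 *: delta_mx 0 i) @[z --> (x, 0)] --> g x.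
    exact: (cvg_comp _ _ ct (gc x)).
  have ct1 : g z.1 @[z --> (x, 0 : R)] --> g x.
    by apply: (@cvg_comp _ _ _ fst g _ _ _ _ (gc x)); exact: cvg_fst.
  have [/= [A B] [Ax B0] AB] := (cvgrPdist_lt _ _).1 ct _ e2.
  have [/= [A' B'] [Ax' B0'] AB'] := (cvgrPdist_lt _ _).1 ct1 _ e2.
  exists (A `&` A', B `&` B') => /=; first by split; apply: filterI.
  move=> [y t] [/= [Ay Ay'] [By By']]; rewrite /P.
  rewrite (splitr e) -(subrKA (g x)) (le_trans (ler_normD _ _)) // lerD //.
    by rewrite distrC ltW // (AB (y, t)).
  by rewrite ltW // (AB' (y, t)).
have [d /= d0 dP] := Kc _ _ P _ Px.
exists d => // x t xc /andP[t0 td]; apply: dP => [|j]; last by rewrite in_itv /=.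
by rewrite /= sub0r normrN ger0_norm.
Qed.

(* Translating the grid by one step in direction [i] permutes it, up to the
   points on the boundary of the cube, where [h] vanishes. *)
Lemma asym_null_pd i h g : has_pd i h g -> continuous g ->
  (forall x, 1 <= \sum_j x 0 j ^+ 2 -> h x = 0) -> asym_null g.
Proof.
move=> hg gc h0.
have m0 : (0 < m)%N by exact: leq_ltn_trans (ltn_ord i).
suff H e : 0 < e -> \forall N \near \oo, `|grid_mean N g| <= e.
  split=> e /H; apply: filterS => N; rewrite ler_norml => /andP[H1 H2] //.
  have -> : - g = -1 \*o g by apply/funext => x; rewrite /= mulN1r.
  by rewrite grid_meanZ mulN1r lerNl.
move=> e0; have [d d0 gd] := unif_shift i gc e0.
near=> N; pose n := grid_side N; pose tau : R := 2 / n%:R.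
have n0 : (0 < n)%N by rewrite /n /grid_side !muln_gt0 m0.
have nR : 0 < n%:R :> R by rewrite ltr0n.
have tau0 : 0 < tau by rewrite divr_gt0.
have taud : tau < d.
  have Nd : N.+1%:R^-1 < d by near: N; exact: near_infty_natSinv_lt (PosNum d0).
  apply: le_lt_trans Nd; rewrite /tau /n /grid_side natrM natrM.
  have m1 : 1 <= m%:R :> R by rewrite ler1n.
  rewrite ler_pdivrMr ?mulr_gt0 ?ltr0n // [_^-1 * _]mulrC mulfK ?pnatr_eq0 //.
  by lra.
pose sg (J : {ffun 'I_m -> 'I_n}) :=
  [ffun j => if j == i then ordS (J j) else J j].
pose sg' (J : {ffun 'I_m -> 'I_n}) :=
  [ffun j => if j == i then ord_pred (J j) else J j].
have sgK : cancel sg sg'.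
  by move=> J; apply/ffunP => j; rewrite !ffunE; case: eqP => // _; rewrite ordSK.
have h_sg J : h (grid_pt (sg J)) = h (grid_pt J + tau *: delta_mx 0 i).
  have out x : `|x 0 i| = 1 -> h x = 0.
    move=> xi; apply: h0; rewrite (bigD1 i) //= -real_normK ?num_real // xi.
    by rewrite expr1n lerDl sumr_ge0 // => j _; rewrite sqr_ge0.
  have [Jn|Jn] := ltnP (J i).+1 n.
    congr h; apply/rowP => j; rewrite !mxE ffunE; case: eqP => [->|ji] /=.
      by rewrite modn_small // mulr1 /tau -addn1 natrD; ring.
    by rewrite mulr0 addr0.
  (* At the last index the wrapped point has coordinate -1 and the translated one coordinate 1; [h]
     vanishes at both. *)
  have Jn1 : ((J i).+1 = n)%N by apply/eqP; rewrite eqn_leq Jn ltn_ord.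
  rewrite !out //; rewrite !mxE ?ffunE eqxx /=.
    rewrite eqxx mulr1 /tau addrAC -mulrDl -{2}[2]mulr1 -mulrDr natr1 Jn1.
    by rewrite mulfK ?gt_eqF // [2]mulr2n addrK normr1.
  by rewrite Jn1 modnn mulr0 mul0r sub0r normrN normr1.
have sum0 : \sum_(J : {ffun 'I_m -> 'I_n})
    (h (grid_pt J + tau *: delta_mx 0 i) - h (grid_pt J)) / tau = 0.
  rewrite -mulr_suml sumrB -(eq_bigr _ (fun J _ => h_sg J)).
  by rewrite [X in _ - X](reindex_inj (can_inj sgK)) subrr mul0r.
(* Subtracting the zero sum compares [g], at each grid point, with a difference quotient of [h],
   which is a value of [g] less than [d] away. *)
rewrite /grid_mean -/n -[X in _ * X]subr0 -[X in _ * (_ - X)]sum0 -sumrB normrM.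
rewrite gtr0_norm ?invr_gt0 ?exprn_gt0 // ler_pdivrMl ?exprn_gt0 //.
apply: le_trans (ler_norm_sum _ _ _) _.
have -> : n%:R ^+ m * e = \sum_(J : {ffun 'I_m -> 'I_n}) e.
  by rewrite sumr_const card_ffun !card_ord -natrX mulr_natl.
apply: ler_sum => J _; set x := grid_pt J.
pose H t := h (x + t *: delta_mx 0 i).
have HD t : is_derive t (1 : R) H (g (x + t *: delta_mx 0 i)).
  by apply: is_derive_line; exact: hg.
have [|c cI] := MVT tau0 (fun t _ => HD t).
  apply: continuous_subspaceT => t; apply: differentiable_continuous.
  exact/derivable1_diffP.
rewrite /H scale0r addr0 subr0 => ->; rewrite mulfK ?gt_eqF // distrC.
apply: gd => [j|]; first exact: grid_pt_itv.
by move: cI; rewrite in_itv /= => /andP[/ltW -> /lt_trans ->].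
Unshelve. all: by end_near. Qed.

End GridMean.

(** * Partial derivatives and integration by parts for functions of class C^k on the ball *)

Section PartialDerivatives.
Variables (R : realType) (m : nat).
Implicit Types (f g h : 'rV[R]_m -> R) (x : 'rV[R]_m) (c d e t : R) (i j : 'I_m).

Lemma has_pd_ext i h g g' : has_pd i h g -> (forall x, g x = g' x) -> has_pd i h g'.
Proof. by move=> hg gg' x; rewrite -gg'. Qed.

Lemma has_pd_cst i c : has_pd i (fun=> c) (fun=> 0 : R).
Proof. by move=> x; apply: is_derive_cst. Qed.

Lemma has_pdD i h g h' g' : has_pd i h h' -> has_pd i g g' ->
  has_pd i (fun x => h x + g x) (fun x => h' x + g' x).
Proof. by move=> hh gg x; apply: is_deriveD. Qed.

Lemma has_pdM i h g h' g' : has_pd i h h' -> has_pd i g g' ->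
  has_pd i (fun x => h x * g x) (fun x => h' x * g x + h x * g' x).
Proof.
move=> hh gg x; apply: is_derive_eq (is_deriveM (hh x) (gg x)) _.
by rewrite scale0r addr0 addrC /GRing.scale /= [h' x * _]mulrC.
Qed.

Lemma has_pdZ i c h h' : has_pd i h h' ->
  has_pd i (fun x => c * h x) (fun x => c * h' x).
Proof.
move=> hh; apply: has_pd_ext (has_pdM (has_pd_cst i c) hh) _ => x.
by rewrite mul0r add0r.
Qed.

Lemma has_pd_coord i j : has_pd i (fun x => x 0 j) (fun=> (j == i)%:R : R).
Proof.
move=> x; have -> : (fun t => (x + t *: delta_mx 0 i) 0 j) =
    cst (x 0 j) + (j == i)%:R \*: (id : R -> R).
  by apply/funext => t; rewrite !mxE /= mulrC.
by apply: is_derive_eq; rewrite add0r /GRing.scale /= mulr1.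
Qed.

Lemma has_pd_comp i (e e' : R -> R) h h' :
  (forall t, is_derive t (1 : R) e (e' t)) -> has_pd i h h' ->
  has_pd i (fun x => e (h x)) (fun x => e' (h x) * h' x).
Proof.
move=> ee hh x; have := is_derive1_comp _ (hh x).
by apply; rewrite scale0r addr0.
Qed.

Lemma has_pd_sum i n (h h' : 'I_n -> 'rV[R]_m -> R) :
  (forall k, has_pd i (h k) (h' k)) ->
  has_pd i (fun x => \sum_k h k x) (fun x => \sum_k h' k x).
Proof.
move=> hh x; have := is_derive_sum (fun k => hh k x).
by congr is_derive; apply/funext => t; rewrite fct_sumE.
Qed.

Definition sqn x := \sum_i x 0 i ^+ 2.

Lemma has_pd_sqn i : has_pd i sqn (fun x => 2 * x 0 i).
Proof.
have H k := has_pdM (has_pd_coord i k) (has_pd_coord i k).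
apply: has_pd_ext (has_pd_sum H) _ => x.
rewrite (bigD1 i) //= eqxx big1 => [|j /negPf ->]; first by rewrite /= addr0; ring.
by rewrite mul0r mulr0 addr0.
Qed.

Lemma continuous_cstf c : continuous (fun _ : 'rV[R]_m => c).
Proof. exact: cst_continuous. Qed.

Lemma continuous_addf h g :
  continuous h -> continuous g -> continuous (fun x => h x + g x).
Proof. move=> hc gc x; exact: (continuousD (hc x) (gc x)). Qed.

Lemma continuous_mulf h g :
  continuous h -> continuous g -> continuous (fun x => h x * g x).
Proof. move=> hc gc x; exact: (continuousM (hc x) (gc x)). Qed.

Lemma continuous_sumf n (h : 'I_n -> 'rV[R]_m -> R) :
  (forall k, continuous (h k)) -> continuous (fun x => \sum_k h k x).
Proof.
move=> hc; have -> : (fun x => \sum_k h k x) = \sum_k h k.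
  by apply/funext => x; rewrite fct_sumE.
elim/big_ind: _ => [|f g|k _]; [|exact: continuous_addf|exact: hc].
exact: (@continuous_cstf 0).
Qed.

Lemma continuous_sqn : continuous sqn.
Proof.
apply: continuous_sumf => k; apply: continuous_mulf; exact: coord_continuous.
Qed.

Lemma derivable_pd i h x : derivable h x (delta_mx 0 i) ->
  is_derive (0 : R) (1 : R) (fun t => h (x + t *: delta_mx 0 i)) (partial i h x).
Proof.
move=> hx; set v := delta_mx 0 i in hx *.
have E : (fun t => t^-1 *: (((fun t => h (x + t *: v)) \o shift 0) (t *: 1) -
      h (x + (0 : R) *: v))) =
    (fun t => t^-1 *: ((h \o shift x) (t *: v) - h x)).
  apply/funext => t /=; rewrite /shift /= scale0r !addr0 [x + _]addrC.
  by rewrite /GRing.scale /= mulr1.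
by split; [rewrite /derivable E | rewrite /derive E].
Qed.

Definition inside d h := forall x, 1 - d <= sqn x -> h x = 0.

(* The product is locally zero at the points outside the ball, where [u] is
   arbitrary. *)
Lemma asym_null_pdM i u (p p' : 'rV[R]_m -> R) d :
  class_C 1 (unit_ball R m) u -> 0 < d ->
  has_pd i p p' -> continuous p -> continuous p' -> inside d p -> inside d p' ->
  asym_null (fun x => partial i u x * p x + u x * p' x).
Proof.
move=> [uc uC] d0 pp' pc p'c dp dp'; have [ud u'c] := uC i.
have out x : ~ unit_ball R m x -> \forall y \near x, 1 - d <= sqn y.
  move=> /negP; rewrite -leNgt => x1.
  have : \forall y \near x, 1 - d < sqn y.
    apply: (cvgr_gt _ (@continuous_sqn x)).
    by rewrite ltrBlDr (le_lt_trans x1) // ltrDl.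
  by apply: filterS => y /ltW.
apply: (@asym_null_pd _ _ i (fun x => u x * p x)).
- move=> x; have [xB|/out xB] := pselect (unit_ball R m x).
    apply: is_derive_eq (is_deriveM (derivable_pd (ud x xB)) (pp' x)) _.
    by rewrite scale0r addr0 addrC /GRing.scale /= [p x * _]mulrC.
  have xo := nbhs_singleton xB; rewrite dp // dp' // !mulr0 addr0.
  apply: (near_eq_is_derive _ (is_derive_cst (0 : R) (0 : R) (1 : R))).
  have : \forall t \near (0 : R), 1 - d <= sqn (x + t *: delta_mx 0 i).
    have ct : x + t *: delta_mx 0 i @[t --> (0 : R)] --> x.
      rewrite -[X in _ --> X]addr0 -(scale0r (delta_mx 0 i)).
      by apply: cvgD; [exact: cvg_cst|apply: cvgZr_tmp; exact: cvg_id].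
    exact: (ct _ xB).
  by apply: filterS => t xt; rewrite dp // mulr0.
- move=> x; have [xB|/out xB] := pselect (unit_ball R m x).
    apply: (@continuousD _ _ _ (fun x => partial i u x * p x) (fun x => u x * p' x)).
      by apply: continuousM; [case: u'c => + _; exact|exact: pc].
    by apply: continuousM; [exact: uc|exact: p'c].
  have xo := nbhs_singleton xB.
  apply: (@cvg_near_cst _ _ _ _ (nbhs x) (nbhs_filter x)).
  by apply: filterS xB => y yB; rewrite !(dp, dp') // !mulr0 addr0.
- by move=> x x1; rewrite dp ?mulr0 // (le_trans _ x1) // gerBl ltW.
Qed.

Lemma class_C_le U k h : class_C k.+1 U h -> class_C k U h.
Proof.
elim: k h => [|k IHk] h [hc hC]; split=> // i.
by have [hd hC'] := hC i; split=> //; apply: IHk.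
Qed.

(** Two integrations by parts; the terms [partial j u x * p1 x] that they share cancel. *)
Lemma asym_null_pd2 i j u (p p1 p2 : 'rV[R]_m -> R) d :
  class_C 2 (unit_ball R m) u -> 0 < d ->
  has_pd i p p1 -> has_pd j p1 p2 ->
  continuous p -> continuous p1 -> continuous p2 ->
  inside d p -> inside d p1 -> inside d p2 ->
  asym_null (fun x => partial i (partial j u) x * p x - u x * p2 x).
Proof.
move=> uC d0 pp1 pp2 pc p1c p2c dp dp1 dp2.
have uC1 := class_C_le uC.
have A := asym_null_pdM uC1 d0 pp2 p1c p2c dp1 dp2.
have B := asym_null_pdM ((proj2 uC j).2) d0 pp1 pc p1c dp dp1.
apply: asym_null_ext (asym_nullD B (asym_nullN A)) => x _.
by rewrite /= !fctE; ring.
Qed.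

End PartialDerivatives.

(** * A C^2 cutoff and its derivatives *)

Section Cutoff.
Variable R : realType.
Implicit Types (t d : R).

Lemma continuous_pos_part n c : continuous (fun t => Num.max (t - c) 0 ^+ n).
Proof.
move=> t; have H : {for t, continuous (fun t => Num.max (t - c) 0)}.
  apply: (@continuous_max _ _ (fun t => t - c) (fun=> 0)); last exact: cvg_cst.
  by apply: cvgB; [exact: cvg_id|exact: cvg_cst].
exact: (continuous_comp H (@exprn_continuous _ n _)).
Qed.

Lemma is_derive_pos_part n t :
  is_derive t (1 : R) (fun t => Num.max t 0 ^+ n.+2) (n.+2%:R * Num.max t 0 ^+ n.+1).
Proof.
case: (ltgtP t 0) => [t0|t0|->].
- rewrite expr0n mulr0.
  apply: (near_eq_is_derive _ (is_derive_cst (0 : R) t (1 : R))).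
  apply: filterS (lt_nbhsl t0) => y y0; rewrite /cst max_r ?expr0n //.
  exact: ltW.
-
  have D : is_derive t (1 : R) (fun t => t ^+ n.+2) (n.+2%:R * t ^+ n.+1).
    have -> : (fun t => t ^+ n.+2) = (id : R -> R) ^+ n.+2 by rewrite exprfctE.
    by apply: is_derive_eq; rewrite /GRing.scale /= mulr1.
  apply: (near_eq_is_derive _ D).
  by apply: filterS (lt_nbhsr t0) => y y0; rewrite max_l // ltW.
- rewrite expr0n mulr0.
  (* Off 0, [q] is exactly the difference quotient at 0. *)
  pose q h : R := Num.max h 0 ^+ n.+1.
  have q0 : q h @[h --> (0 : R)^'] --> (0 : R).
    have qc : {for 0, continuous q}.
      have -> : q = fun t => Num.max (t - 0) 0 ^+ n.+1.
        by apply/funext => t'; rewrite subr0.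
      exact: (@continuous_pos_part n.+1 0 0).
    have q00 : q 0 = 0 by rewrite /q maxxx expr0n.
    move: qc; rewrite /prop_for /continuous_at q00.
    exact: cvg_within_filter.
  have E : h^-1 *: (((fun t => Num.max t 0 ^+ n.+2) \o shift 0) (h *: 1) -
      Num.max (0 : R) 0 ^+ n.+2) @[h --> (0 : R)^'] --> (0 : R).
    apply: cvg_trans q0; apply: near_eq_cvg; near=> h.
    have h0 : h != 0 by near: h; exact: nbhs_dnbhs_neq.
    rewrite /comp /shift addr0 [h *: 1]mulr1 maxxx expr0n subr0 /q.
    case: (ltgtP h 0) h0 => // [hn|hp] _; first by rewrite !expr0n scaler0.
    by rewrite -[RHS]/(h^-1 * _) [in RHS]exprS mulKf // gt_eqF.
  by split; [exact: (cvgP _ E)|exact: (cvg_lim _ E)].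
Unshelve. all: by end_near. Qed.

(** Second difference of truncated powers. For [n = 1] it is a hat function on [[d, 3 d]], so that
    [eta2] has integral 1, its primitive [eta1] rises from 0 to 1, and [eta] is a primitive of
    [eta1]. *)
Definition bump n d t : R :=
  Num.max (t - d) 0 ^+ n - 2 * Num.max (t - 2 * d) 0 ^+ n + Num.max (t - 3 * d) 0 ^+ n.

Definition eta d t := bump 3 d t / (6 * d ^+ 2).
Definition eta1 d t := bump 2 d t / (2 * d ^+ 2).
Definition eta2 d t := bump 1 d t / d ^+ 2.

Lemma is_derive_bump n d t : is_derive t (1 : R) (bump n.+2 d) (n.+2%:R * bump n.+1 d t).
Proof.
have sh c : is_derive t (1 : R) (fun t => Num.max (t - c) 0 ^+ n.+2)
    (n.+2%:R * Num.max (t - c) 0 ^+ n.+1).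
  have D : is_derive t (1 : R) (fun t => t - c) 1.
    by apply: is_derive_eq; rewrite subr0.
  rewrite -[_%:R * _]mulr1.
  exact: (@is_derive1_comp _ _ (fun t => t - c) t _ _ (is_derive_pos_part n (t - c)) D).
apply: is_derive_eq (is_deriveD (is_deriveB (sh d) (is_deriveZ 2 (sh (2 * d)))) (sh (3 * d))) _.
by rewrite /bump /GRing.scale /=; ring.
Qed.

Lemma continuous_bump n d : continuous (bump n d).
Proof.
have sh c := @continuous_pos_part n c.
have c2 : continuous (fun _ : R => 2 : R) by move=> t; apply: cvg_cst.
move=> t; have c2b := continuousM (c2 t) (sh (2 * d) t).
exact: (continuousD (continuousB (sh d t) c2b) (sh (3 * d) t)).
Qed.

Lemma continuous_eta d : continuous (eta d).
Proof. move=> t; exact: (continuousM (@continuous_bump _ d t)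
  (@cst_continuous _ _ (_ : R) t)). Qed.

Lemma continuous_eta1 d : continuous (eta1 d).
Proof. move=> t; exact: (continuousM (@continuous_bump _ d t)
  (@cst_continuous _ _ (_ : R) t)). Qed.

Lemma continuous_eta2 d : continuous (eta2 d).
Proof. move=> t; exact: (continuousM (@continuous_bump _ d t)
  (@cst_continuous _ _ (_ : R) t)). Qed.

Lemma is_derive_eta d t : 0 < d -> is_derive t (1 : R) (eta d) (eta1 d t).
Proof.
move=> d0; have -> : eta d = (6 * d ^+ 2)^-1 \*: bump 3 d.
  by apply/funext => s; rewrite /eta /GRing.scale /= mulrC.
apply: is_derive_eq (is_deriveZ _ (is_derive_bump 1 d t)) _.
by rewrite /eta1 /GRing.scale /=; field; rewrite gt_eqF.
Qed.

Lemma is_derive_eta1 d t : 0 < d -> is_derive t (1 : R) (eta1 d) (eta2 d t).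
Proof.
move=> d0; have -> : eta1 d = (2 * d ^+ 2)^-1 \*: bump 2 d.
  by apply/funext => s; rewrite /eta1 /GRing.scale /= mulrC.
apply: is_derive_eq (is_deriveZ _ (is_derive_bump 0 d t)) _.
by rewrite /eta2 /GRing.scale /=; field; rewrite gt_eqF.
Qed.

Lemma bump_le n d t : 0 <= d -> t <= d -> bump n.+1 d t = 0.
Proof. by move=> d0 td; rewrite /bump !max_r ?expr0n /=; lra. Qed.

Lemma eta_le d t : 0 <= d -> t <= d -> eta d t = 0.
Proof. by move=> d0 td; rewrite /eta bump_le ?mul0r. Qed.

Lemma eta1_le d t : 0 <= d -> t <= d -> eta1 d t = 0.
Proof. by move=> d0 td; rewrite /eta1 bump_le ?mul0r. Qed.

Lemma eta2_le d t : 0 <= d -> t <= d -> eta2 d t = 0.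
Proof. by move=> d0 td; rewrite /eta2 bump_le ?mul0r. Qed.

(** On the two middle pieces [s] is the distance to the nearer end of [[d, 3 d]], in units of [d];
    bounds on the cutoff become polynomial inequalities on [[0, 1]]. *)
Variant cutoff_spec d t : R -> R -> R -> Type :=
| CutoffLow of t <= d : cutoff_spec d t 0 0 0
| CutoffRise s of 0 <= s & s <= 1 & t = d * (1 + s) :
    cutoff_spec d t (d * s ^+ 3 / 6) (s ^+ 2 / 2) (s / d)
| CutoffFall s of 0 <= s & s <= 1 & t = d * (3 - s) :
    cutoff_spec d t (d * (1 - s + s ^+ 3 / 6)) (1 - s ^+ 2 / 2) (s / d)
| CutoffHigh of 3 * d <= t : cutoff_spec d t (t - 2 * d) 1 0.

Lemma cutoffP d t : 0 < d -> cutoff_spec d t (eta d t) (eta1 d t) (eta2 d t).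
Proof.
move=> d0; have d1 : d != 0 by rewrite gt_eqF.
have [td|dt] := leP t d.
  by rewrite eta_le ?eta1_le ?eta2_le ?(ltW d0) //; constructor.
have [td2|dt2] := leP t (2 * d).
  have -> : eta d t = d * ((t - d) / d) ^+ 3 / 6.
    by rewrite /eta /bump max_l ?max_r; [field|lra|lra|lra].
  have -> : eta1 d t = ((t - d) / d) ^+ 2 / 2.
    by rewrite /eta1 /bump max_l ?max_r; [field|lra|lra|lra].
  have -> : eta2 d t = ((t - d) / d) / d.
    by rewrite /eta2 /bump max_l ?max_r; [field|lra|lra|lra].
  constructor; [|rewrite ler_pdivrMr //; lra|by field].
  by rewrite divr_ge0 // ?ltW // subr_gt0.
have [td3|dt3] := leP t (3 * d).
  have -> : eta d t = d * (1 - (3 * d - t) / d + ((3 * d - t) / d) ^+ 3 / 6).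
    by rewrite /eta /bump [Num.max (t - 3 * d) 0]max_r ?max_l; [field|lra|lra|lra].
  have -> : eta1 d t = 1 - ((3 * d - t) / d) ^+ 2 / 2.
    by rewrite /eta1 /bump [Num.max (t - 3 * d) 0]max_r ?max_l; [field|lra|lra|lra].
  have -> : eta2 d t = ((3 * d - t) / d) / d.
    by rewrite /eta2 /bump [Num.max (t - 3 * d) 0]max_r ?max_l; [field|lra|lra|lra].
  constructor; [|rewrite ler_pdivrMr //; lra|by field].
  by rewrite divr_ge0 ?subr_ge0 // ltW.
have -> : eta d t = t - 2 * d.
  by rewrite /eta /bump !max_l; [field|lra|lra|lra].
have -> : eta1 d t = 1.
  by rewrite /eta1 /bump !max_l; [field|lra|lra|lra].
have -> : eta2 d t = 0.
  by rewrite /eta2 /bump !max_l; [field|lra|lra|lra].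
by constructor; exact: ltW.
Qed.

Lemma eta1_ge d t : 3 * d <= t -> 0 < d -> eta1 d t = 1.
Proof. by move=> dt d0; rewrite /eta1 /bump !max_l; [field; rewrite gt_eqF|lra|lra|lra]. Qed.

Lemma eta1_itv d t : 0 < d -> 0 <= eta1 d t <= 1.
Proof. by move=> d0; case: (cutoffP t d0) => // *; nra. Qed.

Lemma eta2_ge0 d t : 0 < d -> 0 <= eta2 d t.
Proof. by move=> d0; case: (cutoffP t d0) => // s *; rewrite divr_ge0 // ltW. Qed.

Lemma eta2_ge d t : 3 * d <= t -> 0 < d -> eta2 d t = 0.
Proof. by move=> dt d0; rewrite /eta2 /bump !max_l; [field; rewrite gt_eqF|lra|lra|lra]. Qed.

(** The left-hand side would be 0 for the positive part of [t]; smoothing costs [O(d)], namely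
    [2 * d] from [3 * d] on. *)
Lemma eta1_eta d t : 0 < d -> t * eta1 d t - eta d t <= 3 * d.
Proof.
move=> d0; case: (cutoffP t d0) => [|s s0 s1 ->|s s0 s1 ->|]; [lra| | |lra].
  have : 0 <= d * (s ^+ 3 / 6) by rewrite mulr_ge0 ?(ltW d0) // divr_ge0 ?exprn_ge0.
  have : d * ((1 + s) * (s ^+ 2 / 2)) <= d * 3 by rewrite ler_pM2l //; nra.
  lra.
have : 0 <= d * (1 - s + s ^+ 3 / 6).
  by rewrite mulr_ge0 ?(ltW d0) // addr_ge0 ?subr_ge0 // divr_ge0 ?exprn_ge0.
have : d * ((3 - s) * (1 - s ^+ 2 / 2)) <= d * 3.
  by rewrite ler_pM2l //; have := sqr_ge0 s; nra.
lra.
Qed.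

End Cutoff.

(** * Real parts of powers of a planar complex coordinate *)

Section PlanarHarmonics.
Variables (R : realType) (m : nat) (i0 i1 : 'I_m).
Hypothesis i01 : i0 != i1.
Implicit Types (x : 'rV[R]_m) (i : 'I_m) (a b c : R[i]) (j k l : nat).

(** The derivative of [planeC] in direction [i]. *)
Definition dirC i : R[i] := Complex (i0 == i)%:R (i1 == i)%:R.

Definition planeC x : R[i] := Complex (x 0 i0) (x 0 i1).

Definition iC : R[i] := Complex 0 1.

Definition rho x := x 0 i0 ^+ 2 + x 0 i1 ^+ 2.

(** The coefficient [c] makes the family stable under differentiation and planar rotation;
    [harm iC k] is minus the imaginary part of [planeC x ^+ k]. *)
Definition harm c k x := complex.Re (c * planeC x ^+ k).

Lemma ReM_lin s t c :
  s * complex.Re c + t * complex.Re (iC * c) = complex.Re (Complex s t * c) :> R.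
Proof. by case: c => p q; rewrite /= ; ring. Qed.

Lemma ReZ (s : nat) c : s%:R * complex.Re c = complex.Re (s%:R * c) :> R.
Proof. by rewrite !mulr_natl raddfMn. Qed.

Lemma harmS c k x :
  harm c k.+1 x = x 0 i0 * harm c k x + x 0 i1 * harm (iC * c) k x.
Proof. by rewrite /harm -[iC * c * _]mulrA ReM_lin exprS mulrCA. Qed.

Lemma harm0 c x : harm c 0 x = complex.Re c.
Proof. by rewrite /harm expr0 mulr1. Qed.

Lemma continuous_harm c k : continuous (harm c k).
Proof.
elim: k c => [|k IHk] c.
  have -> : harm c 0 = fun=> complex.Re c by apply/funext => x; rewrite harm0.
  exact: continuous_cstf.
have -> : harm c k.+1 = fun x => x 0 i0 * harm c k x + x 0 i1 * harm (iC * c) k x.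
  by apply/funext => x; rewrite harmS.
by apply: continuous_addf; apply: continuous_mulf => //; exact: coord_continuous.
Qed.

Lemma has_pd_harm i c k :
  has_pd i (harm c k) (fun x => k%:R * harm (dirC i * c) k.-1 x).
Proof.
elim: k c => [|k IHk] c.
  have -> : harm c 0 = fun=> complex.Re c by apply/funext => x; rewrite harm0.
  by apply: has_pd_ext (has_pd_cst i (complex.Re c)) _ => x; rewrite mul0r.
have -> : harm c k.+1 = fun x => x 0 i0 * harm c k x + x 0 i1 * harm (iC * c) k x.
  by apply/funext => x; rewrite harmS.
have H0 := has_pdM (has_pd_coord i i0) (IHk c).
have H1 := has_pdM (has_pd_coord i i1) (IHk (iC * c)).
apply: has_pd_ext (has_pdD H0 H1) _ => x.
rewrite addrACA /harm -[iC * c * _]mulrA ReM_lin.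
rewrite [dirC i * (iC * c)]mulrCA -[iC * _ * planeC x ^+ k.-1]mulrA.
rewrite !ReZ [k%:R * (iC * _)]mulrCA ReM_lin -raddfD; congr complex.Re.
rewrite -/(dirC i) -/(planeC x); case: k {IHk H0 H1} => [|k] /=.
  by rewrite mul0r mulr0 addr0 !expr0 !mulr1 mul1r.
by rewrite exprS -[k.+2%:R]natr1; ring.
Qed.

Lemma dir_sum (F : 'I_m -> R) : (forall i, i != i0 -> i != i1 -> F i = 0) ->
  \sum_i F i = F i0 + F i1.
Proof.
move=> F0; rewrite (bigD1 i0) //= (bigD1 i1) 1?eq_sym //= big1 ?addr0 // => i.
by case/andP => *; exact: F0.
Qed.

Lemma dirC0 i : i != i0 -> i != i1 -> dirC i = 0.
Proof. by rewrite /dirC ![_ == i]eq_sym => /negPf -> /negPf ->. Qed.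

Lemma dirC_i0 : dirC i0 = 1.
Proof. by rewrite /dirC eqxx eq_sym (negPf i01). Qed.

Lemma dirC_i1 : dirC i1 = iC.
Proof. by rewrite /dirC eqxx (negPf i01). Qed.

Lemma iC_sqr : iC * iC = -1.
Proof. by apply/eqP; rewrite eq_complex /=; apply/andP; split; apply/eqP; ring. Qed.

Lemma harm_c0 k x : harm 0 k x = 0.
Proof. by rewrite /harm mul0r. Qed.

Lemma harmN c k x : harm (- c) k x = - harm c k x.
Proof. by rewrite /harm mulNr raddfN. Qed.

Lemma harm_euler c k x : \sum_i x 0 i * harm (dirC i * c) k x = harm c k.+1 x.
Proof.
rewrite dir_sum ?dirC_i0 ?dirC_i1 ?mul1r ?harmS //.
by move=> i ? ?; rewrite dirC0 // mul0r harm_c0 mulr0.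
Qed.

(** The squares of the [dirC i] add up to [1 + iC * iC = 0]. *)
Lemma harm_laplace c k x : \sum_i harm (dirC i * (dirC i * c)) k x = 0.
Proof.
rewrite dir_sum ?dirC_i0 ?dirC_i1.
  by rewrite !mul1r mulrA iC_sqr mulN1r harmN subrr.
by move=> i ? ?; rewrite dirC0 // !mul0r harm_c0.
Qed.

Lemma harm_sqr k x : harm 1 k x ^+ 2 + harm iC k x ^+ 2 = rho x ^+ k.
Proof.
elim: k => [|k IHk]; first by rewrite !harm0 /= expr0; ring.
rewrite [RHS]exprS -IHk !harmS mulr1 iC_sqr harmN /rho; ring.
Qed.

Lemma rho_ge0 x : 0 <= rho x.
Proof. by rewrite addr_ge0 ?sqr_ge0. Qed.

Lemma rho_le x : rho x <= sqn x.
Proof.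
rewrite /rho /sqn (bigD1 i0) //= (bigD1 i1) 1?eq_sym //= addrA lerDl.
by rewrite sumr_ge0 // => j _; rewrite sqr_ge0.
Qed.

(** The even exponent keeps the modulus of the power of [planeC x] a polynomial, without square
    root. *)
Lemma harm1_le l x : `|harm 1 (l + l) x| <= rho x ^+ l.
Proof.
rewrite -(@ler_pXn2r _ 2) ?nnegrE ?exprn_ge0 ?rho_ge0 // real_normK ?num_real //.
by rewrite -exprM muln2 -addnn -harm_sqr lerDl sqr_ge0.
Qed.

Lemma harmi_le l x : `|harm iC (l + l) x| <= rho x ^+ l.
Proof.
rewrite -(@ler_pXn2r _ 2) ?nnegrE ?exprn_ge0 ?rho_ge0 // real_normK ?num_real //.
by rewrite -exprM muln2 -addnn -harm_sqr lerDr sqr_ge0.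
Qed.

Lemma harm1_le1 k x : rho x <= 1 -> `|harm 1 k x| <= 1.
Proof.
move=> r1; rewrite -(@ler_pXn2r _ 2) ?nnegrE // real_normK ?num_real //.
rewrite expr1n (le_trans _ (exprn_ile1 k (rho_ge0 x) r1)) //.
by rewrite -harm_sqr lerDl sqr_ge0.
Qed.

(** * Divergence identities with a radial weight *)

Section RadialWeight.
(** The pair is [(eta, eta1)] for relations between integrals over the ball, and [(eta1, eta2)] to
    pass from the ball to the sphere. *)
Variables (d : R) (e e' : R -> R).
Hypothesis d_gt0 : 0 < d.
Hypothesis ee' : forall t, is_derive t (1 : R) e (e' t).
Hypothesis e_cont : continuous e.
Hypothesis e'_cont : continuous e'.
Hypothesis e_le : forall t, t <= d -> e t = 0.

Lemma has_pd_radial i :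
  has_pd i (fun x => e (1 - sqn x)) (fun x => - (2 * x 0 i * e' (1 - sqn x))).
Proof.
have H := has_pdD (has_pd_cst i (1 : R)) (has_pdZ (-1) (has_pd_sqn i)).
have K := has_pd_comp ee' H.
have -> : (fun x => e (1 - sqn x)) = (fun x => e (1 + -1 * sqn x)).
  by apply/funext => x; rewrite mulN1r.
by apply: has_pd_ext K _ => x; rewrite mulN1r; ring.
Qed.

Lemma continuous_radial (f : R -> R) :
  continuous f -> continuous (fun x => f (1 - sqn x)).
Proof.
move=> fc x; have H : {for x, continuous (fun x : 'rV[R]_m => 1 - sqn x)}.
  exact: (continuousB (@continuous_cstf R m 1 x) (@continuous_sqn _ _ x)).
exact: (continuous_comp H (fc _)).
Qed.

Lemma asym_null_radial i (F F' : 'rV[R]_m -> R) :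
  has_pd i F F' -> continuous F -> continuous F' ->
  asym_null (fun x => F' x * e (1 - sqn x) - 2 * x 0 i * F x * e' (1 - sqn x)).
Proof.
move=> FF' Fc F'c; apply: asym_null_ext; last first.
  apply: (asym_null_pd (has_pdM FF' (has_pd_radial i))).
    apply: continuous_addf; apply: continuous_mulf => //.
      exact: continuous_radial.
    have -> : (fun x : 'rV[R]_m => - (2 * x 0 i * e' (1 - sqn x))) =
        (fun x => (- 2 * x 0 i) * e' (1 - sqn x)).
      by apply/funext => x; ring.
    apply: continuous_mulf; last exact: continuous_radial.
    apply: continuous_mulf; last exact: coord_continuous.
    exact: continuous_cstf.
  by move=> x x1; rewrite e_le ?mulr0 // (le_trans _ (ltW d_gt0)) // subr_le0.
by move=> x _ /=; ring.
Qed.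

Lemma continuous_coordM i (F : 'rV[R]_m -> R) :
  continuous F -> continuous (fun x => x 0 i * F x).
Proof. by move=> Fc; apply: continuous_mulf => //; exact: coord_continuous. Qed.

Lemma has_pd_coordM i (j' : 'I_m) (F F' : 'rV[R]_m -> R) : has_pd i F F' ->
  has_pd i (fun x => x 0 j' * F x) (fun x => (j' == i)%:R * F x + x 0 j' * F' x).
Proof. by move=> FF'; exact: (has_pdM (has_pd_coord i j') FF'). Qed.

(** Divergence of the field [x] times [F] and the weight: homogeneity of [F] produces [m + n], and
    differentiating the weight along [x] produces [sqn x]. *)
Lemma asym_null_euler (n : nat) (F : 'rV[R]_m -> R) (F' : 'I_m -> 'rV[R]_m -> R) :
  (forall i, has_pd i F (F' i)) -> continuous F -> (forall i, continuous (F' i)) ->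
  (forall x, \sum_i x 0 i * F' i x = n%:R * F x) ->
  asym_null (fun x => (m + n)%:R * F x * e (1 - sqn x)
                      - 2 * sqn x * F x * e' (1 - sqn x)).
Proof.
move=> FF' Fc F'c E.
have N i := asym_null_radial (has_pd_coordM i (FF' i)) (continuous_coordM Fc)
  (continuous_addf (continuous_mulf (@continuous_cstf R m _) Fc)
    (continuous_coordM (F'c i))).
apply: asym_null_ext (asym_null_sum (index_enum _) (P := xpredT) (fun i _ => N i)).
move=> x _ /=; rewrite sumrB -mulr_suml big_split /= E; congr (_ * _ - _).
  under eq_bigr => i _ do rewrite eqxx mul1r.
  by rewrite sumr_const card_ord natrD mulrDl mulr_natl.
rewrite /sqn mulr_sumr !mulr_suml; apply: eq_bigr => i _; ring.
Qed.

(** Here the field is the planar part of [x], whose divergence is 2 and whose scalar product with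
    [x] is [rho x]. *)
Lemma asym_null_planar_euler (n : nat) (F : 'rV[R]_m -> R)
    (F' : 'I_m -> 'rV[R]_m -> R) :
  (forall i, has_pd i F (F' i)) -> continuous F -> (forall i, continuous (F' i)) ->
  (forall x, x 0 i0 * F' i0 x + x 0 i1 * F' i1 x = n%:R * F x) ->
  asym_null (fun x => (2 + n)%:R * F x * e (1 - sqn x)
                      - 2 * rho x * F x * e' (1 - sqn x)).
Proof.
move=> FF' Fc F'c E.
have N i := asym_null_radial (has_pd_coordM i (FF' i)) (continuous_coordM Fc)
  (continuous_addf (continuous_mulf (@continuous_cstf R m _) Fc)
    (continuous_coordM (F'c i))).
apply: asym_null_ext (asym_nullD (N i0) (N i1)) => x _.
rewrite /= !fctE !eqxx /= natrD mulrDl -E /rho; ring.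
Qed.

(** The planar rotation field is divergence-free and tangent to the spheres, so the derivative of
    the weight drops out. *)
Lemma asym_null_rot (F : 'rV[R]_m -> R) (F' : 'I_m -> 'rV[R]_m -> R) :
  (forall i, has_pd i F (F' i)) -> continuous F -> (forall i, continuous (F' i)) ->
  asym_null (fun x => (x 0 i0 * F' i1 x - x 0 i1 * F' i0 x) * e (1 - sqn x)).
Proof.
move=> FF' Fc F'c.
have A := asym_null_radial (has_pd_coordM i0 (FF' i1)) (continuous_coordM Fc)
  (continuous_addf (continuous_mulf (@continuous_cstf R m _) Fc)
    (continuous_coordM (F'c i1))).
have B := asym_null_radial (has_pd_coordM i1 (FF' i0)) (continuous_coordM Fc)
  (continuous_addf (continuous_mulf (@continuous_cstf R m _) Fc)
    (continuous_coordM (F'c i0))).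
apply: asym_null_ext (asym_nullD A (asym_nullN B)) => x _.
by rewrite /= !fctE [i1 == i0]eq_sym (negPf i01) /=; ring.
Qed.

End RadialWeight.

End PlanarHarmonics.

(** * Products of planar harmonics against radial weights *)

Section HarmonicProducts.
Variables (R : realType) (m : nat) (i0 i1 : 'I_m).
Hypothesis i01 : i0 != i1.
Implicit Types (x : 'rV[R]_m) (i : 'I_m) (a b c : R[i]) (j k l : nat).
Local Notation harm := (harm i0 i1).
Local Notation rho := (rho i0 i1).
Local Notation dirC := (dirC R i0 i1).
Local Notation iC := (iC R).

Definition dharm c k i x := k%:R * harm (dirC i * c) k.-1 x.

Definition dharmM a j b k i x := dharm a j i x * harm b k x + harm a j x * dharm b k i x.

Lemma continuous_dharm c k i : continuous (dharm c k i).
Proof.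
apply: continuous_mulf; [exact: continuous_cstf|exact: continuous_harm].
Qed.

Lemma continuous_harmM a j b k : continuous (fun x => harm a j x * harm b k x).
Proof. by apply: continuous_mulf; exact: continuous_harm. Qed.

Lemma continuous_dharmM a j b k i : continuous (dharmM a j b k i).
Proof.
by apply: continuous_addf; apply: continuous_mulf;
  solve [exact: continuous_harm | exact: continuous_dharm].
Qed.

Lemma has_pd_harmM a j b k i :
  has_pd i (fun x => harm a j x * harm b k x) (dharmM a j b k i).
Proof. exact: (has_pdM (@has_pd_harm _ _ _ _ i a j) (@has_pd_harm _ _ _ _ i b k)). Qed.

Lemma dharm_euler c k x : \sum_i x 0 i * dharm c k i x = k%:R * harm c k x.
Proof.
rewrite /dharm; under eq_bigr => i _ do rewrite mulrCA.
rewrite -mulr_sumr harm_euler //; case: k => [|k] //; by rewrite !mul0r.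
Qed.

Lemma dharm_planar_euler c k x :
  x 0 i0 * dharm c k i0 x + x 0 i1 * dharm c k i1 x = k%:R * harm c k x.
Proof.
rewrite -dharm_euler (dir_sum i01) // => i ? ?.
by rewrite /dharm dirC0 // mul0r harm_c0 !mulr0.
Qed.

Lemma dharm_rot c k x :
  x 0 i0 * dharm c k i1 x - x 0 i1 * dharm c k i0 x = k%:R * harm (iC * c) k x.
Proof.
rewrite /dharm (dirC_i0 _ i01) (dirC_i1 _ i01) mul1r.
case: k => [|k]; first by rewrite !mul0r !mulr0 subrr.
by rewrite harmS mulrA iC_sqr mulN1r harmN /=; ring.
Qed.

Section Null.
Variables (d : R) (e e' : R -> R).
Hypothesis d_gt0 : 0 < d.
Hypothesis ee' : forall t, is_derive t (1 : R) e (e' t).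
Hypothesis e_cont : continuous e.
Hypothesis e'_cont : continuous e'.
Hypothesis e_le : forall t, t <= d -> e t = 0.

Lemma asym_null_harmM_euler a j b k :
  asym_null (fun x => (m + (j + k))%:R * (harm a j x * harm b k x) * e (1 - sqn x)
                      - 2 * sqn x * (harm a j x * harm b k x) * e' (1 - sqn x)).
Proof.
apply: (asym_null_euler d_gt0 ee' e_cont e'_cont e_le (has_pd_harmM a j b k)).
- exact: continuous_harmM.
- exact: continuous_dharmM.
move=> x; rewrite natrD mulrDl [in RHS]mulrA -dharm_euler.
rewrite [k%:R * _]mulrCA -(dharm_euler b) mulr_suml mulr_sumr -big_split.
by apply: eq_bigr => i _; rewrite /dharmM /=; ring.
Qed.

Lemma asym_null_harmM_planar a j b k :
  asym_null (fun x => (2 + (j + k))%:R * (harm a j x * harm b k x) * e (1 - sqn x)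
                      - 2 * rho x * (harm a j x * harm b k x) * e' (1 - sqn x)).
Proof.
apply: (asym_null_planar_euler d_gt0 ee' e_cont e'_cont e_le (has_pd_harmM a j b k)).
- exact: continuous_harmM.
- exact: continuous_dharmM.
move=> x; rewrite natrD mulrDl [in RHS]mulrA -dharm_planar_euler.
rewrite [k%:R * _]mulrCA -(dharm_planar_euler b).
by rewrite /dharmM /=; ring.
Qed.

Lemma asym_null_harmM_rot a j b k :
  asym_null (fun x => (j%:R * harm (iC * a) j x * harm b k x
                       + k%:R * harm a j x * harm (iC * b) k x) * e (1 - sqn x)).
Proof.
have := asym_null_rot i01 d_gt0 ee' e_cont e'_cont e_le (has_pd_harmM a j b k)
  (@continuous_harmM a j b k) (@continuous_dharmM a j b k).
apply: asym_null_ext => x _.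
rewrite -dharm_rot [k%:R * _]mulrC -[X in _ = (_ - _) * X]mulr1 -!mulrA -dharm_rot.
by rewrite /dharmM; ring.
Qed.

(** Write P for [harm 1] and I for [harm iC]. Rotating P_j I_k and I_j P_k gives two linear
    relations between the means of P_j P_k and I_j I_k; eliminating the latter leaves the factor
    [j ^ 2 - k ^ 2]. *)
Lemma asym_null_harm_orth j k : j != k ->
  asym_null (fun x => harm 1 j x * harm 1 k x * e (1 - sqn x)).
Proof.
move=> jk; have A := asym_null_harmM_rot 1 j iC k.
have B := asym_null_harmM_rot iC j 1 k.
have D := asym_nullD (asym_nullZ k%:R A) (asym_nullZ (- j%:R) B).
have jk0 : j%:R ^+ 2 - k%:R ^+ 2 != 0 :> R.
  by rewrite subr_eq0 eqrXn2 ?ler0n // eqr_nat.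
apply: asym_null_ext (asym_nullZ (j%:R ^+ 2 - k%:R ^+ 2)^-1 D) => x _.
rewrite /= !fctE /= mulr1 iC_sqr !harmN.
by field.
Qed.

(** Rotating the product of [harm 1 k] and [harm iC k] shows that their squares have equal weighted
    means, and the sum of the squares is [rho ^ k]. *)
Lemma asym_null_harm_sqr k : (0 < k)%N ->
  asym_null (fun x => (2 * (harm 1 k x * harm 1 k x) - rho x ^+ k) * e (1 - sqn x)).
Proof.
move=> k0; have k0R : k%:R != 0 :> R by rewrite pnatr_eq0 -lt0n.
apply: asym_null_ext (asym_nullZ (- k%:R^-1) (asym_null_harmM_rot 1 k iC k)) => x _.
by rewrite /= mulr1 iC_sqr harmN -(harm_sqr i0 i1); field.
Qed.

(** [rho ^ l] is a sum of two squares of harmonics of degree [l], to which the identity for products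
    applies. *)
Lemma asym_null_rho_euler l :
  asym_null (fun x => (m + 2 * l)%:R * rho x ^+ l * e (1 - sqn x)
                      - 2 * sqn x * rho x ^+ l * e' (1 - sqn x)).
Proof.
have N := asym_nullD (asym_null_harmM_euler 1 l 1 l) (asym_null_harmM_euler iC l iC l).
apply: asym_null_ext N => x _.
by rewrite /= !fctE -(harm_sqr i0 i1) mul2n -addnn; ring.
Qed.

Lemma asym_null_rho_planar l :
  asym_null (fun x => (2 + 2 * l)%:R * rho x ^+ l * e (1 - sqn x)
                      - 2 * rho x ^+ l.+1 * e' (1 - sqn x)).
Proof.
have N := asym_nullD (asym_null_harmM_planar 1 l 1 l) (asym_null_harmM_planar iC l iC l).
apply: asym_null_ext N => x _.
by rewrite /= !fctE exprSr -(harm_sqr i0 i1) mul2n -addnn; ring.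
Qed.

End Null.

End HarmonicProducts.

(** * Moments of [rho] over the ball and the sphere *)

Section RadialMoments.
Variables (R : realType) (m : nat) (i0 i1 : 'I_m).
Hypothesis i01 : i0 != i1.
Implicit Types (x : 'rV[R]_m) (d : R).
Local Notation rho := (rho i0 i1).

(** The integral of [rho ^ (l + 1)] over the unit ball divided by that of [rho ^ l]. *)
Definition ratio l : R := 2 * l.+1%:R / (m + 2 * l.+1)%:R.

Lemma ratio_den_gt0 l : 0 < (m + 2 * l.+1)%:R :> R.
Proof. by rewrite ltr0n addn_gt0 orbT. Qed.

Lemma ratio_itv l : 0 <= ratio l <= 1.
Proof.
rewrite divr_ge0 ?mulr_ge0 ?ler0n //= ler_pdivrMr ?ratio_den_gt0 // mul1r.
by rewrite -natrM ler_nat leq_addl.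
Qed.

Lemma ratio_homo l k : (l <= k)%N -> ratio l <= ratio k.
Proof.
move=> lk; rewrite ler_pdivrMr ?ratio_den_gt0 // mulrAC ler_pdivlMr ?ratio_den_gt0 //.
by rewrite -!natrM ler_nat; nia.
Qed.

(** From [1 + y <= expR y] at [y = m / (2 (l + 1))]. The bound is uniform in [l]: about doubling the
    degree costs the moment a bounded factor only. *)
Lemma ratio_exp l : (expR (m%:R / 2))^-1 <= ratio l ^+ l.+1.
Proof.
have := ler0n R l; have := ler0n R m => m0 l0.
have -> : ratio l = (1 + m%:R / (2 * l.+1%:R))^-1.
  rewrite /ratio natrD natrM; field.
  by apply/andP; split; rewrite gt_eqF //; lra.
have y0 : 0 <= m%:R / (2 * l.+1%:R) :> R by rewrite divr_ge0 ?mulr_ge0.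
rewrite exprVn lef_pV2 ?posrE ?expR_gt0 ?exprn_gt0 ?ltr_wpDr //.
have -> : m%:R / 2 = l.+1%:R * (m%:R / (2 * l.+1%:R)) :> R.
  by field; rewrite gt_eqF //; lra.
by rewrite expRM_natl lerXn2r ?nnegrE ?expR_ge0 ?expR_ge1Dx // addr_ge0.
Qed.

(* The two Euler identities give exactly
   [2 (l + 1) eta' rho^l = (m + 2 (l + 1)) eta' rho^(l + 1)] in the limit
   where [eta d t] is replaced by the positive part of [t]. *)
Lemma asym_npos_rhoS l d : 0 < d ->
  asym_npos (fun x => ratio l * (rho x ^+ l * eta1 d (1 - sqn x))
                      - rho x ^+ l.+1 * eta1 d (1 - sqn x) - 3 * d).
Proof.
move=> d0; have A := asym_null_rho_euler i01 d0 (fun t => is_derive_eta t d0)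
  (@continuous_eta _ d) (@continuous_eta1 _ d)
  (fun t => eta_le (ltW d0)) l.
have B := asym_null_rho_planar i01 d0 (fun t => is_derive_eta t d0)
  (@continuous_eta _ d) (@continuous_eta1 _ d)
  (fun t => eta_le (ltW d0)) l.
have q0 := ratio_den_gt0 l; set q := (m + 2 * l.+1)%:R in q0 *.
(* These weights leave [ratio l * rho ^ l * eta1 - rho ^ (l + 1) * eta1] minus the defect
   [ratio l * (s * eta1 - eta) * rho ^ l], which [eta1_eta] controls. *)
have N := asym_nullD (asym_nullZ (- (l.+1%:R / q)) A) (asym_nullZ (1 / 2) B).
apply: asym_npos_le N.1 => x _; rewrite /= !fctE /=.
set s := 1 - sqn x; set E := eta1 d s; set H := eta d s.
have key : (s * E - H) * rho x ^+ l <= 3 * d.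
  have r0 := rho_ge0 i0 i1 x.
  have [s0|s0] := leP s 0.
    rewrite /E /H eta_le ?eta1_le ?(le_trans s0) ?(ltW d0) //.
    by rewrite mulr0 subr0 mul0r mulr_ge0 // ltW.
  have r1 : rho x ^+ l <= 1.
    rewrite exprn_ile1 // (le_trans (rho_le i01 x)) //.
    by move: s0; rewrite /s; lra.
  have := eta1_eta s d0; rewrite -/E -/H => EH.
  have : 0 <= rho x ^+ l by rewrite exprn_ge0.
  have [w0|w0] := leP 0 (s * E - H); nra.
have lq : 0 <= l.+1%:R / q <= 1 / 2.
  rewrite divr_ge0 ?ler0n ?(ltW q0) //= ler_pdivrMr // /q natrD natrM.
  have := ler0n R m; lra.
have key2 : 2 * (l.+1%:R / q) * ((s * E - H) * rho x ^+ l) <= 3 * d.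
  have [w0|w0] := leP 0 ((s * E - H) * rho x ^+ l); last by nra.
  by nra.
rewrite -subr_ge0; rewrite -subr_ge0 in key2.
apply: le_trans key2 _; rewrite le_eqVlt; apply/orP; left; apply/eqP.
rewrite /ratio -/q exprS.
have -> : sqn x = 1 - s by rewrite /s; ring.
rewrite /q natrD natrM; field.
by rewrite gt_eqF //; have := ler0n R m; have := ler0n R l; lra.
Qed.

(** [ratio] increases with the degree, so [ratio l] bounds all [n] successive factors from below;
    being at most 1, it lets the errors [3 * d] merely add up. *)
Lemma asym_npos_rho_iter l n d : 0 < d ->
  asym_npos (fun x => ratio l ^+ n * (rho x ^+ l * eta1 d (1 - sqn x))
                      - rho x ^+ (l + n) * eta1 d (1 - sqn x) - n%:R * (3 * d)).
Proof.
move=> d0; have [r0 r1] := andP (ratio_itv l).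
elim: n => [|n IHn].
  apply: asym_npos_le (@asym_npos0 R m) => x _.
  by rewrite expr0 mul1r addn0 mul0r subrr subr0.
apply: asym_npos_le (asym_nposD (asym_nposZ r0 IHn) (asym_npos_rhoS (l + n) d0)).
move=> x _; rewrite /= !fctE /= addnS exprS -natr1.
set E := eta1 d _; set P := rho x ^+ l.
set Q := rho x ^+ (l + n); set T := ratio l ^+ n.
have E0 : 0 <= Q * E.
  by rewrite mulr_ge0 ?exprn_ge0 ?rho_ge0 //; case/andP: (eta1_itv (1 - sqn x) d0).
have rr : ratio l * (Q * E) <= ratio (l + n) * (Q * E).
  by rewrite ler_wpM2r // ratio_homo // leq_addr.
have : ratio l * (n%:R * (3 * d)) <= n%:R * (3 * d).
  by rewrite ler_piMl // mulr_ge0 ?ler0n // mulr_ge0 // ltW.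
set V := n%:R * (3 * d); have -> : (n%:R + 1) * (3 * d) = V + 3 * d by rewrite /V; ring.
set Z := rho x ^+ _.+1; nra.
Qed.

(** Compares the two powers attached to the degree k = 2 l + 1: [rho ^ l], which bounds the test
    field, and [rho ^ k], which comes from the square of P_k. *)
Lemma asym_npos_rho_double l d : 0 < d ->
  asym_npos (fun x => (expR (m%:R / 2))^-1 * (rho x ^+ l * eta1 d (1 - sqn x))
     - rho x ^+ (l + l.+1) * eta1 d (1 - sqn x) - l.+1%:R * (3 * d)).
Proof.
move=> d0; apply: asym_npos_le (asym_npos_rho_iter l l.+1 d0) => x _.
rewrite !lerB // ler_wpM2r ?ratio_exp // mulr_ge0 ?exprn_ge0 ?rho_ge0 //.
by case/andP: (eta1_itv (1 - sqn x) d0).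
Qed.

(** By Euler's identity in degree 0, [2 * sqn x * eta2] has asymptotically the mean of [m * eta1],
    which is at most [m]; and [6 * d <= 1] forces [sqn x >= 1 / 2] wherever [eta2] is nonzero. *)
Lemma asym_npos_eta2 d : 0 < d -> 6 * d <= 1 ->
  asym_npos (fun x => eta2 d (1 - sqn x) - m%:R).
Proof.
move=> d0 d6; have A := asym_null_rho_euler i01 d0 (fun t => is_derive_eta1 t d0)
  (@continuous_eta1 _ d) (@continuous_eta2 _ d)
  (fun t => eta1_le (ltW d0)) 0.
apply: asym_npos_le (asym_nullN A).1 => x _; rewrite !fctE expr0 !mulr1 muln0 addn0.
have [E0 E1] := andP (eta1_itv (1 - sqn x) d0).
have e0 := eta2_ge0 (1 - sqn x) d0.
have mE : m%:R * eta1 d (1 - sqn x) <= m%:R by rewrite ler_piMr ?ler0n.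
have [s3|s3] := leP (3 * d) (1 - sqn x); first by rewrite eta2_ge //; lra.
have : eta2 d (1 - sqn x) <= 2 * sqn x * eta2 d (1 - sqn x).
  by rewrite ler_peMl //; lra.
lra.
Qed.

(* [eta2 d (1 - sqn x)] tends to the surface measure as [d] decreases, so that
   these are the integrals of [P_j P_k] over the sphere. *)
Lemma asym_null_eta2_orth j k d : 0 < d -> j != k ->
  asym_null (fun x => 2 * sqn x * (harm i0 i1 1 j x * harm i0 i1 1 k x)
    * eta2 d (1 - sqn x)).
Proof.
move=> d0 jk; have A := asym_null_harmM_euler i01 d0 (fun t => is_derive_eta1 t d0)
  (@continuous_eta1 _ d) (@continuous_eta2 _ d)
  (fun t => eta1_le (ltW d0)) 1 j 1 k.
have B := asym_null_harm_orth i01 d0 (fun t => is_derive_eta1 t d0)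
  (@continuous_eta1 _ d) (@continuous_eta2 _ d)
  (fun t => eta1_le (ltW d0)) jk.
apply: asym_null_ext (asym_nullD (asym_nullN A) (asym_nullZ (m + (j + k))%:R B)).
by move=> x _; rewrite /= !fctE /=; ring.
Qed.

(** The factor [m + 2 k], the ratio of sphere to ball integrals in degree 2 k, is the growth that a
    bounded solution cannot match. *)
Lemma asym_null_eta2_sqr k d : 0 < d -> (0 < k)%N ->
  asym_null (fun x => 2 * sqn x * (harm i0 i1 1 k x * harm i0 i1 1 k x)
    * eta2 d (1 - sqn x) - (m + 2 * k)%:R / 2 * (rho x ^+ k * eta1 d (1 - sqn x))).
Proof.
move=> d0 k0; have A := asym_null_harmM_euler i01 d0 (fun t => is_derive_eta1 t d0)
  (@continuous_eta1 _ d) (@continuous_eta2 _ d)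
  (fun t => eta1_le (ltW d0)) 1 k 1 k.
have B := asym_null_harm_sqr i01 d0 (fun t => is_derive_eta1 t d0)
  (@continuous_eta1 _ d) (@continuous_eta2 _ d)
  (fun t => eta1_le (ltW d0)) k0.
apply: asym_null_ext (asym_nullD (asym_nullN A) (asym_nullZ ((m + 2 * k)%:R / 2) B)).
by move=> x _; rewrite /= !fctE /= mul2n -addnn; field.
Qed.

End RadialMoments.

(** * The vector part of a symmetric sandwich product *)

Section CliffordTrace.
Variables (R : realType) (m : nat).
Implicit Types (a b : clifford R m) (i j k : 'I_m) (h : 'I_m -> 'I_m -> R).
Local Notation e i := (cliff_gen R i).

Definition cliff_trace a : R := a finset.set0.

Lemma cliff_traceC a b : cliff_trace (a * b) = cliff_trace (b * a).
Proof.
rewrite /cliff_trace !ffunE; apply: eq_bigr => A _.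
by rewrite symdiff0 mulrAC.
Qed.

Lemma cliff_trace_gen k a : cliff_trace (e k * a) = - a [set k]%SET.
Proof.
rewrite /cliff_trace ffunE (bigD1 [set k]%SET) //= big1 ?addr0 => [|A AC].
  rewrite symdiff0 ffunE eqxx mulr1 /cliff_sign big_set1.
  rewrite (eq_bigl (pred1 k)) ?big_pred1_eq ?mulN1r //.
  by move=> j; rewrite finset.in_set1 /=; case: eqP => // ->; rewrite leqnn.
by rewrite ffunE (negbTE AC) mulr0 mul0r.
Qed.

Lemma cliff_gen_acomm i j : e i * e j + e j * e i = - (2 * (i == j)%:R) *: 1.
Proof.
case: eqVneq => [->|ij].
  by rewrite -expr2 cliff_gen_sqr mulr1 scaleNr scaler_nat -mulr2n mulNrn.
by rewrite cliff_gen_anticomm // addNr mulr0 oppr0 scale0r.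
Qed.

(** Adding the sum to its transpose turns every product of generators into an anticommutator. *)
Lemma cliff_sym_sqr h : (forall i j, h i j = h j i) ->
  \sum_i \sum_j h i j *: (e j * e i) = - (\sum_i h i i) *: 1.
Proof.
move=> hs; set X := \sum_i _.
have XX : X + X = - (2 * \sum_i h i i) *: 1.
  rewrite {1}/X exchange_big /X -big_split /=.
  rewrite mulr_sumr -sumrN scaler_suml; apply: eq_bigr => i _.
  rewrite -big_split (bigD1 i) //= big1 => [|j ji].
    by rewrite -scalerDr cliff_gen_acomm eqxx mulr1 scalerA addr0 mulrN [_ * 2]mulrC.
  by rewrite [h j i]hs -scalerDr cliff_gen_acomm eq_sym (negPf ji) mulr0 oppr0 scale0r scaler0.
have n2 : (2 : R) != 0 by rewrite pnatr_eq0.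
by apply: (scalerI n2); rewrite scaler_nat mulr2n XX scalerA mulrN.
Qed.

(** The coefficient of [e k] is minus the scalar part of [e k] times the sum. Cyclicity of the
    scalar part gathers the generators on one side of [a], where symmetry of [h] reduces them to a
    vector; hence only the vector part of [a] enters. With a Hessian for [h] this yields Delta - 2
    grad div. *)
Lemma cliff_sandwich_vector h a k : (forall i j, h i j = h j i) ->
  (\sum_i \sum_j h i j *: (e i * a * e j)) [set k]%SET =
  (\sum_i h i i) * a [set k]%SET - 2 * \sum_j h k j * a [set j]%SET.
Proof.
move=> hs; set S := \sum_i _.
apply: oppr_inj; rewrite -cliff_trace_gen.
have -> : e k * S = \sum_i \sum_j h i j *: (e k * e i * a * e j).
  rewrite mulr_sumr; apply: eq_bigr => i _; rewrite mulr_sumr; apply: eq_bigr => j _.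
  by rewrite -scalerAr !mulrA.
have traceS (F : 'I_m -> clifford R m) : cliff_trace (\sum_i F i) = \sum_i cliff_trace (F i).
  by rewrite /cliff_trace sum_ffunE.
have traceZ c b : cliff_trace (c *: b) = c * cliff_trace b by rewrite /cliff_trace ffunE.
have T : cliff_trace (\sum_i \sum_j h i j *: (e k * e i * a * e j)) =
    cliff_trace ((\sum_i \sum_j h i j *: (e j * e k * e i)) * a).
  rewrite mulr_suml !traceS; apply: eq_bigr => i _.
  rewrite mulr_suml !traceS; apply: eq_bigr => j _.
  by rewrite -scalerAl !traceZ cliff_traceC !mulrA.
have E : \sum_i \sum_j h i j *: (e j * e k * e i) =
    (\sum_i h i i) *: e k - 2 *: \sum_j h k j *: e j.
  have -> : (\sum_i h i i) *: e k = - (e k * \sum_i \sum_j h i j *: (e j * e i)).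
    by rewrite cliff_sym_sqr // -scalerAr mulr1 scaleNr opprK.
  have -> : 2 *: \sum_j h k j *: e j = \sum_i \sum_j (2 * (j == k)%:R * h i j) *: e i.
    rewrite scaler_sumr; apply: eq_bigr => i _; rewrite (bigD1 k) //= big1 => [|j jk].
      by rewrite eqxx mulr1 addr0 scalerA hs.
    by rewrite (negPf jk) mulr0 mul0r scale0r.
  rewrite mulr_sumr -sumrN -sumrB; apply: eq_bigr => i _.
  rewrite mulr_sumr -sumrN -sumrB; apply: eq_bigr => j _.
  have -> : e j * e k = - (e k * e j) - (2 * (j == k)%:R) *: 1.
    by rewrite -scaleNr -cliff_gen_acomm addrC addrK.
  rewrite mulrBl mulNr -scalerAl mul1r scalerBr scalerN scalerA.
  congr (_ - _ *: _); last by ring.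
  by rewrite -mulrA scalerAr.
have traceB a' b' : cliff_trace (a' - b') = cliff_trace a' - cliff_trace b'.
  by rewrite /cliff_trace !ffunE.
rewrite T E mulrBl traceB -!scalerAl mulr_suml !traceZ traceS cliff_trace_gen.
under [X in _ - _ * X]eq_bigr => j _ do rewrite -scalerAl traceZ cliff_trace_gen mulrN.
by rewrite sumrN; ring.
Qed.

End CliffordTrace.

(** * Weak form of the equation *)

Section WeakEquation.
Variables (R : realType) (m : nat) (f : 'rV[R]_m -> clifford R m) (d : R).
Hypothesis fC2 : cliff_class_C 2 (unit_ball R m) f.
Hypothesis f_eq : forall x, unit_ball R m x -> diracl (diracr f) x = 0.
Hypothesis d_gt0 : 0 < d.
Variables (p : 'rV[R]_m -> R) (p1 : 'I_m -> 'rV[R]_m -> R)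
  (p2 : 'I_m -> 'I_m -> 'rV[R]_m -> R).
Hypothesis pp1 : forall i, has_pd i p (p1 i).
Hypothesis pp2 : forall i j, has_pd j (p1 i) (p2 i j).
Hypothesis p_cont : continuous p.
Hypothesis p1_cont : forall i, continuous (p1 i).
Hypothesis p2_cont : forall i j, continuous (p2 i j).
Hypothesis p2_sym : forall i j x, p2 i j x = p2 j i x.
Hypothesis p_in : inside d p.
Hypothesis p1_in : forall i, inside d (p1 i).
Hypothesis p2_in : forall i j, inside d (p2 i j).
Local Notation e i := (cliff_gen R i).

Lemma asym_null_weak k :
  asym_null (fun x => (\sum_i p2 i i x) * f x [set k]%SET
    - 2 * \sum_j p2 k j x * f x [set j]%SET).
Proof.
(* Matrix entries of the linear form sending [a] to the [e k] coefficient of [e i * a * e j]; they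
   reduce the claim to single coordinates of [f]. *)
pose T i j A : R := (e i * cliff_blade R A * e j) [set k]%SET.
have TE i j (a : clifford R m) : (e i * a * e j) [set k]%SET = \sum_A T i j A * a A.
  rewrite {1}[a]cliff_coordE mulr_sumr mulr_suml sum_ffunE.
  by apply: eq_bigr => A _; rewrite -scalerAr -scalerAl ffunE mulrC.
pose G i j A x := T i j A *
  (partial i (partial j (cliff_coord A f)) x * p x - f x A * p2 i j x).
have G0 i j A : asym_null (G i j A).
  apply: asym_nullZ; exact: (asym_null_pd2 (fC2 A) d_gt0 (pp1 i) (pp2 i j)).
have N : asym_null (fun x => \sum_i \sum_j \sum_A G i j A x).
  by do 3![apply: asym_null_sum => ? _].
apply: asym_null_ext (asym_nullN N) => x _.
rewrite -(cliff_sandwich_vector (f x) k (fun i j => p2_sym i j x)) opprfctE /=.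
have eq0 : p x * (\sum_i \sum_j
    e i * cliff_partial i (cliff_partial j f) x * e j) [set k]%SET = 0.
  have [xB|/negP xB] := pselect (unit_ball R m x).
    by rewrite -(diraclrE fC2 xB) f_eq // ffunE mulr0.
  by rewrite p_in ?mul0r // (le_trans _ (_ : 1 <= sqn x)) ?gerBl ?(ltW d_gt0) // leNgt.
rewrite -[LHS]subr0 -[X in _ - X]eq0 !sum_ffunE mulr_sumr -sumrB -sumrN.
apply: eq_bigr => i _; rewrite !sum_ffunE mulr_sumr -sumrB -sumrN.
apply: eq_bigr => j _; rewrite ffunE !TE !mulr_sumr -sumrB -sumrN.
apply: eq_bigr => A _; rewrite /G ffunE.
have -> : cliff_coord A (cliff_partial j f) = partial j (cliff_coord A f).
  exact: cliff_coord_partial.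
by ring.
Qed.

End WeakEquation.

(** * The test field: a cut-off gradient of a planar harmonic *)

Section TestField.
Variables (R : realType) (m : nat) (i0 i1 : 'I_m).
Hypothesis i01 : i0 != i1.
Variables (d : R) (n : nat).
Hypothesis d_gt0 : 0 < d.
Implicit Types (x : 'rV[R]_m) (i j k : 'I_m).
Local Notation harm := (harm i0 i1).
Local Notation dharm := (dharm i0 i1).
Local Notation dirC := (dirC R i0 i1).

Let E x := eta d (1 - sqn x).
Let E1 x := eta1 d (1 - sqn x).
Let E2 x := eta2 d (1 - sqn x).

(** Component [k] of the gradient of [harm 1 n.+1], divided by the degree [n.+1]. *)
Definition fgrad k := harm (dirC k) n.
Definition fgrad1 k i := dharm (dirC k) n i.
Definition fgrad2 k i j x := n%:R * dharm (dirC i * dirC k) n.-1 j x.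

Definition field k x := fgrad k x * E x.
Definition field1 k i x := fgrad1 k i x * E x - 2 * x 0 i * fgrad k x * E1 x.
Definition field2 k i j x :=
  fgrad2 k i j x * E x - 2 * x 0 j * fgrad1 k i x * E1 x
  - 2 * (i == j)%:R * fgrad k x * E1 x - 2 * x 0 i * fgrad1 k j x * E1 x
  + 4 * x 0 i * x 0 j * fgrad k x * E2 x.

Let E_pd i : has_pd i E (fun x => - (2 * x 0 i * E1 x)).
Proof. by apply: has_pd_radial => t; apply: is_derive_eta. Qed.

Let E1_pd i : has_pd i E1 (fun x => - (2 * x 0 i * E2 x)).
Proof. by apply: has_pd_radial => t; apply: is_derive_eta1. Qed.

Let E_cont : continuous E.
Proof. by apply: continuous_radial; exact: continuous_eta. Qed.

Let E1_cont : continuous E1.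
Proof. by apply: continuous_radial; exact: continuous_eta1. Qed.

Let E2_cont : continuous E2.
Proof. by apply: continuous_radial; exact: continuous_eta2. Qed.

Lemma fgrad_pd k i : has_pd i (fgrad k) (fgrad1 k i).
Proof. exact: has_pd_harm. Qed.

Lemma fgrad1_pd k i j : has_pd j (fgrad1 k i) (fgrad2 k i j).
Proof. by apply: has_pdZ; exact: has_pd_harm. Qed.

Lemma field_pd k i : has_pd i (field k) (field1 k i).
Proof.
apply: has_pd_ext (has_pdM (fgrad_pd k i) (E_pd i)) _ => x.
by rewrite /field1; ring.
Qed.

Lemma field1_pd k i j : has_pd j (field1 k i) (field2 k i j).
Proof.
have A := has_pdM (fgrad1_pd k i j) (E_pd j).
have B := has_pdM (has_pdM (has_pd_coord j i) (fgrad_pd k j)) (E1_pd j).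
have D := has_pdD A (has_pdZ (-2) B).
have -> : field1 k i = fun x => fgrad1 k i x * E x + -2 * (x 0 i * fgrad k x * E1 x).
  by apply/funext => x; rewrite /field1; ring.
by apply: has_pd_ext D _ => x; rewrite /field2; ring.
Qed.

Let fgrad_cont k : continuous (fgrad k).
Proof. exact: continuous_harm. Qed.

Let fgrad1_cont k i : continuous (fgrad1 k i).
Proof. exact: continuous_dharm. Qed.

Let fgrad2_cont k i j : continuous (fgrad2 k i j).
Proof.
by apply: continuous_mulf; [exact: continuous_cstf|exact: continuous_dharm].
Qed.

Let coord_cont i : continuous (fun x => x 0 i).
Proof. exact: coord_continuous. Qed.

Let cst_cont (c : R) : continuous (fun _ : 'rV[R]_m => c).
Proof. exact: continuous_cstf. Qed.

Lemma continuous_field k : continuous (field k).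
Proof. exact: continuous_mulf. Qed.

Lemma continuous_field1 k i : continuous (field1 k i).
Proof.
have -> : field1 k i = fun x => fgrad1 k i x * E x + -2 * (x 0 i * fgrad k x * E1 x).
  by apply/funext => x; rewrite /field1; ring.
apply: continuous_addf; first exact: continuous_mulf.
apply: continuous_mulf; first exact: cst_cont.
by apply: continuous_mulf; first exact: continuous_mulf.
Qed.

Lemma continuous_field2 k i j : continuous (field2 k i j).
Proof.
have -> : field2 k i j = fun x =>
    fgrad2 k i j x * E x + (-2 * (x 0 j * fgrad1 k i x
    + (i == j)%:R * fgrad k x + x 0 i * fgrad1 k j x) * E1 x
    + 4 * (x 0 i * x 0 j) * fgrad k x * E2 x).
  by apply/funext => x; rewrite /field2; ring.
by repeat match goal with
  | |- continuous (fun x => _ + _) => apply: continuous_addf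
  | |- continuous (fun x => _ * _) => apply: continuous_mulf
  end.
Qed.

Let out x : 1 - d <= sqn x -> 1 - sqn x <= d.
Proof. by move=> ?; lra. Qed.

Lemma field_inside k : inside d (field k).
Proof. by move=> x /out xd; rewrite /field /E eta_le ?mulr0 // ltW. Qed.

Lemma field1_inside k i : inside d (field1 k i).
Proof.
move=> x /out xd; rewrite /field1 /E /E1 eta_le ?eta1_le ?(ltW d_gt0) //.
by rewrite !mulr0 subrr.
Qed.

Lemma field2_inside k i j : inside d (field2 k i j).
Proof.
move=> x /out xd; rewrite /field2 /E /E1 /E2 eta_le ?eta1_le ?eta2_le ?(ltW d_gt0) //.
by rewrite !mulr0 !subr0 addr0.
Qed.

Lemma fgrad2_sym k i j x : fgrad2 k i j x = fgrad2 k j i x.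
Proof. by rewrite /fgrad2 /dharm [dirC j * _]mulrCA. Qed.

Lemma field2_sym k i j x : field2 k i j x = field2 k j i x.
Proof. by rewrite /field2 fgrad2_sym eq_sym; ring. Qed.

Lemma fgrad_euler x : \sum_i x 0 i * fgrad i x = harm 1 n.+1 x.
Proof. by rewrite -(harm_euler i01); apply: eq_bigr => i _; rewrite mulr1. Qed.

Lemma fgrad1_euler k x : \sum_i x 0 i * fgrad1 k i x = n%:R * fgrad k x.
Proof. exact: dharm_euler. Qed.

Lemma fgrad1C k i x : fgrad1 k i x = fgrad1 i k x.
Proof. by rewrite /fgrad1 /dharm [dirC i * _]mulrC. Qed.

Lemma fgrad1_div x : \sum_i fgrad1 i i x = 0.
Proof.
rewrite -mulr_sumr; under eq_bigr => i _ do rewrite -[dirC i * dirC i]mulr1 -mulrA.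
by rewrite harm_laplace ?mulr0.
Qed.

Lemma fgrad2_laplace k x : \sum_i fgrad2 k i i x = 0.
Proof. by rewrite -!mulr_sumr harm_laplace ?mulr0. Qed.

Lemma fgrad2_div j x : \sum_k fgrad2 k k j x = 0.
Proof.
rewrite -!mulr_sumr; under eq_bigr => k _ do rewrite mulrCA [dirC j * _]mulrC.
by rewrite harm_laplace ?mulr0.
Qed.

Lemma field_laplace k x : \sum_i field2 k i i x =
  (- 4 * n%:R - 2 * m%:R) * fgrad k x * E1 x + 4 * sqn x * fgrad k x * E2 x.
Proof.
have F i : field2 k i i x = E x * fgrad2 k i i x - 4 * E1 x * (x 0 i * fgrad1 k i x)
    - 2 * fgrad k x * E1 x + 4 * fgrad k x * E2 x * x 0 i ^+ 2.
  by rewrite /field2 eqxx /=; ring.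
transitivity (E x * \sum_i fgrad2 k i i x - 4 * E1 x * \sum_i x 0 i * fgrad1 k i x
    - \sum_(i < m) 2 * fgrad k x * E1 x + 4 * fgrad k x * E2 x * sqn x).
  rewrite (eq_bigr _ (fun i _ => F i)) /sqn.
  by rewrite ![_ * (\sum_i _)]mulr_sumr -!sumrB -big_split.
rewrite fgrad2_laplace fgrad1_euler sumr_const card_ord -[_ *+ m]mulr_natl.
by ring.
Qed.

Lemma field_graddiv j x : \sum_k field2 k k j x =
  - 2 * (1 + n%:R) * fgrad j x * E1 x + 4 * x 0 j * harm 1 n.+1 x * E2 x.
Proof.
have F k : field2 k k j x = E x * fgrad2 k k j x - 2 * x 0 j * E1 x * fgrad1 k k x
    - 2 * E1 x * ((k == j)%:R * fgrad k x) - 2 * E1 x * (x 0 k * fgrad1 j k x)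
    + 4 * x 0 j * E2 x * (x 0 k * fgrad k x).
  by rewrite /field2 (fgrad1C k j); ring.
transitivity (E x * \sum_k fgrad2 k k j x - 2 * x 0 j * E1 x * \sum_k fgrad1 k k x
    - 2 * E1 x * \sum_k (k == j)%:R * fgrad k x
    - 2 * E1 x * \sum_k x 0 k * fgrad1 j k x
    + 4 * x 0 j * E2 x * \sum_k x 0 k * fgrad k x).
  rewrite (eq_bigr _ (fun k _ => F k)).
  by rewrite ![_ * (\sum_i _)]mulr_sumr -!sumrB -big_split.
rewrite fgrad2_div fgrad1_div fgrad1_euler fgrad_euler.
rewrite (bigD1 j) //= big1 => [|k /negPf ->]; last by rewrite mul0r.
by rewrite eqxx /=; ring.
Qed.

Variable f : 'rV[R]_m -> clifford R m.
Hypothesis fC2 : cliff_class_C 2 (unit_ball R m) f.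
Hypothesis f_eq : forall x, unit_ball R m x -> diracl (diracr f) x = 0.

(** In [field_laplace] minus twice [field_graddiv] the coefficient of [eta1] is
    [- 4 n - 2 m + 4 (1 + n) = 4 - 2 m], independent of the degree; the identity is then halved. *)
Lemma asym_null_field :
  asym_null (fun x => \sum_i f x [set i]%SET *
    ((2 - m%:R) * harm (dirC i) n x * E1 x
     + (2 * sqn x * harm (dirC i) n x - 4 * x 0 i * harm 1 n.+1 x) * E2 x)).
Proof.
have N k := asym_null_weak fC2 f_eq d_gt0 (field_pd k) (field1_pd k)
  (@continuous_field k) (@continuous_field1 k) (@continuous_field2 k)
  (field2_sym k) (@field_inside k) (@field1_inside k) (@field2_inside k) k.
have S := asym_null_sum (index_enum _) (P := xpredT) (fun k _ => N k).
apply: asym_null_ext (asym_nullZ (1 / 2) S) => x _ /=.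
have -> : \sum_k ((\sum_i field2 k i i x) * f x [set k]%SET
      - 2 * \sum_j field2 k k j x * f x [set j]%SET) =
    \sum_i f x [set i]%SET *
      (\sum_j field2 i j j x - 2 * \sum_k field2 k k i x).
  rewrite sumrB -mulr_sumr exchange_big /= mulr_sumr -sumrB.
  by apply: eq_bigr => i _; rewrite -mulr_suml; ring.
rewrite [in RHS]mulr_sumr; apply: eq_bigr => i _.
by rewrite field_laplace field_graddiv -/(fgrad i x); field.
Qed.

End TestField.

(** * Dyadic series with bounded coefficients *)

Section DyadicSum.
Variable R : realType.
Implicit Types (c : nat -> R) (n j k : nat).

Definition dyadic_term c : R^nat := fun j => (1 / 2) ^+ j * c j.

Definition dyadic_sum c : R := limn (series (dyadic_term c)).

Lemma half_gt0 n : 0 < (1 / 2 : R) ^+ n.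
Proof. by rewrite exprn_gt0. Qed.

Lemma is_cvg_dyadic c : (forall j, `|c j| <= 1) -> cvgn (series (dyadic_term c)).
Proof.
move=> c1; apply: normed_cvg.
apply: (@series_le_cvg _ _ (geometric 1 (1 / 2))) => [n|n|n|].
- exact: normr_ge0.
- by rewrite /= mul1r ltW // half_gt0.
- rewrite /= mul1r /dyadic_term normrM gtr0_norm ?half_gt0 //.
  by rewrite ler_piMr // ltW // half_gt0.
- by apply: is_cvg_geometric_series; rewrite ger0_norm; lra.
Qed.

Lemma dyadic_partial c n k : (forall j, `|c j| <= 1) ->
  `|series (dyadic_term c) (n + k)%N - series (dyadic_term c) n| <=
  2 * (1 / 2) ^+ n - 2 * (1 / 2) ^+ (n + k).
Proof.
move=> c1; elim: k => [|k IHk]; first by rewrite addn0 !subrr normr0.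
rewrite addnS /series /= big_nat_recr //= addrAC (le_trans (ler_normD _ _)) //.
have T : `|dyadic_term c (n + k)| <= (1 / 2) ^+ (n + k).
  rewrite /dyadic_term normrM gtr0_norm ?half_gt0 //.
  by rewrite ler_piMr // ltW // half_gt0.
rewrite (le_trans (lerD IHk T)) // exprS.
by set h := (_ ^+ (n + k)); lra.
Qed.

Lemma dyadic_tail c n : (forall j, `|c j| <= 1) ->
  `|dyadic_sum c - series (dyadic_term c) n| <= 2 * (1 / 2) ^+ n.
Proof.
move=> c1; have cc := is_cvg_dyadic c1.
pose w k := `|series (dyadic_term c) k - series (dyadic_term c) n|.
have wc : w k @[k --> \oo] --> `|dyadic_sum c - series (dyadic_term c) n|.
  by apply: cvg_norm; apply: cvgB; [exact: cc|exact: cvg_cst].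
rewrite -(cvg_lim _ wc) //; apply: limr_le; first exact: cvgP wc.
near=> k; have nk : (n <= k)%N by near: k; exact: nbhs_infty_ge.
rewrite /w -(subnKC nk) (le_trans (dyadic_partial n (k - n) c1)) //.
by rewrite gerBl mulr_ge0 // ltW // half_gt0.
Unshelve. all: by end_near. Qed.

Lemma dyadic_sumZ s c : (forall j, `|c j| <= 1) ->
  dyadic_sum (fun j => s * c j) = s * dyadic_sum c.
Proof.
move=> c1; rewrite /dyadic_sum -[RHS](lim_seriesZ s (is_cvg_dyadic c1)).
by congr (limn (series _)); apply/funext => j; rewrite /dyadic_term /= mulrCA.
Qed.

Lemma dyadic_sum_gap c c' J : (forall j, `|c j| <= 1) -> (forall j, `|c' j| <= 1) ->
  (forall j, c' j <= c j) ->
  (1 / 2) ^+ J * (c J - c' J) <= dyadic_sum c - dyadic_sum c'.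
Proof.
move=> c1 c'1 cc'.
rewrite /dyadic_sum -lim_seriesB; try exact: is_cvg_dyadic.
apply: limr_ge; first by apply: is_cvg_seriesB; exact: is_cvg_dyadic.
near=> n; have Jn : (J < n)%N by near: n; exact: nbhs_infty_gt.
rewrite /series /= big_mkord (bigD1 (Ordinal Jn)) //=.
rewrite !fctE /dyadic_term -mulrBr lerDl sumr_ge0 // => j _.
by rewrite -mulrBr mulr_ge0 ?subr_ge0 // ltW // half_gt0.
Unshelve. all: by end_near. Qed.

Lemma half_lt (e : R) : 0 < e -> exists n, 2 * (1 / 2) ^+ n < e.
Proof.
move=> e0; have : (geometric 2 (1 / 2) : R^nat) n @[n --> \oo] --> (0 : R).
  by apply: cvg_geometric; rewrite ger0_norm; lra.
move=> /cvgrPdist_lt /(_ e e0) [n _ /(_ n (leqnn n))] /=.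
by rewrite sub0r normrN ger0_norm ?mulr_ge0 ?(ltW (half_gt0 n)) // => ?; exists n.
Qed.

End DyadicSum.

(** * The boundary data *)

Section BoundaryData.
Variables (R : realType) (m : nat) (i0 i1 : 'I_m).
Hypothesis i01 : i0 != i1.
Implicit Types (x : 'rV[R]_m) (i : 'I_m).
Local Notation harm := (harm i0 i1).

(* The degrees are sparse enough that [(1 / 2) ^ j * freq j] is unbounded. *)
Definition freq j := (4 ^ j + (4 ^ j).+1)%N.

Definition clip (t : R) := Num.max (-1) (Num.min t 1).

(* The clipping makes the series of modes converge on the whole of R^m. *)
Definition mode j x := clip (harm 1 (freq j) x).

Definition amp x := dyadic_sum (mode^~ x).

Definition radial_data x : clifford R m :=
  \sum_i (x 0 i * amp x) *: cliff_gen R i.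

Lemma clip_norm t : `|clip t| <= 1.
Proof. by rewrite ler_norml /clip le_max lexx /= ge_max ge_min lexx orbT andbT; lra. Qed.

Lemma clip_id t : `|t| <= 1 -> clip t = t.
Proof. by rewrite ler_norml /clip => /andP[? ?]; rewrite min_l // max_r. Qed.

Lemma mode_norm j x : `|mode j x| <= 1.
Proof. exact: clip_norm. Qed.

Lemma modeE j x : sqn x <= 1 -> mode j x = harm 1 (freq j) x.
Proof.
move=> x1; apply/clip_id/harm1_le1.
exact: le_trans (rho_le i01 x) x1.
Qed.

Lemma continuous_mode j : continuous (mode j).
Proof.
move=> x; have hc := @continuous_harm R m i0 i1 1 (freq j) x.
have cc := @continuous_cstf R m 1 x.
have cn := @continuous_cstf R m (-1) x.
have := continuous_max cn (continuous_min hc cc).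
by [].
Qed.

Lemma continuous_amp : continuous amp.
Proof.
move=> x; apply: (cvgrPdist_lt (F := nbhs x) _ _).2 => e e0.
have [n ne] := half_lt (divr_gt0 e0 (ltr0n R 3)).
pose S y := \sum_(j < n) (1 / 2) ^+ j * mode j y.
have Sc : continuous S.
  by apply: continuous_sumf => j; apply: continuous_mulf;
    [exact: continuous_cstf|exact: continuous_mode].
have ampS y : `|amp y - S y| < e / 3.
  apply: le_lt_trans ne; have := dyadic_tail n (mode_norm^~ y).
  by rewrite /series /= big_mkord.
have e3 : 0 < e / 3 by rewrite divr_gt0.
have H := (cvgrPdist_lt _ _).1 (Sc x) _ e3.
near=> y; have Sxy : `|S x - S y| < e / 3 by near: y; exact: H.
move: (ampS x) (ampS y) Sxy; rewrite /=.
move: (amp x) (amp y) (S x) (S y) => a b s s'; rewrite !ltr_norml; lra.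
Unshelve. all: by end_near. Qed.

Lemma radial_data_vector x i : radial_data x [set i]%SET = x 0 i * amp x.
Proof.
rewrite /radial_data sum_ffunE (bigD1 i) //= big1 => [|j ji].
  by rewrite !ffunE eqxx mulr1 addr0.
rewrite !ffunE; case: eqP => [/esym/set1_inj jE|_]; last by rewrite mulr0.
by rewrite jE eqxx in ji.
Qed.

Lemma continuous_radial_data A : continuous (cliff_coord A radial_data).
Proof.
have -> : cliff_coord A radial_data = fun x =>
    \sum_i (x 0 i * amp x) * cliff_gen R i A.
  by apply/funext => x; rewrite /cliff_coord sum_ffunE; apply: eq_bigr => i _; rewrite ffunE.
apply: continuous_sumf => i; apply: continuous_mulf; last exact: continuous_cstf.
by apply: continuous_mulf; [exact: coord_continuous|exact: continuous_amp].
Qed.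

End BoundaryData.

(** * Failure of C^1 regularity on the sphere *)

Section NotC1.
Variable R : realType.
Implicit Types (t C r : R).

Lemma norm_increment_le (F F' : R -> R) t C :
  (forall s, `|s| <= `|t| -> is_derive s (1 : R) F (F' s) /\ `|F' s| <= C) ->
  `|F t - F 0| <= C * `|t|.
Proof.
move=> HF.
have cont a b : (forall s, s \in `[a, b] -> `|s| <= `|t|) ->
    {within `[a, b], continuous F}.
  move=> ab; apply: derivable_within_continuous => s /ab /HF [D _].
  exact: ex_derive.
case: (ltgtP t 0) => [t0|t0|->]; last by rewrite subrr normr0 mulr0.
- have sub s : s \in `[t, 0] -> `|s| <= `|t|.
    rewrite in_itv /= => /andP[ts s0].
    by rewrite !ler0_norm ?(ltW t0) // lerN2.
  have D s : s \in `]t, 0[ -> is_derive s (1 : R) F (F' s).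
    by move=> sI; exact: (HF s (sub s (subset_itv_oo_cc sI))).1.
  have [c cI E] := MVT t0 D (cont _ _ sub).
  have [_ Fc] := HF c (sub c (subset_itv_oo_cc cI)).
  by rewrite -normrN opprB E normrM sub0r normrN ler_wpM2r.
have sub s : s \in `[0, t] -> `|s| <= `|t|.
  rewrite in_itv /= => /andP[s0 st].
  by rewrite !ger0_norm ?(ltW t0).
have D s : s \in `]0, t[ -> is_derive s (1 : R) F (F' s).
  by move=> sI; exact: (HF s (sub s (subset_itv_oo_cc sI))).1.
have [c cI ->] := MVT t0 D (cont _ _ sub).
have [_ Fc] := HF c (sub c (subset_itv_oo_cc cI)).
by rewrite normrM subr0 ler_wpM2r.
Qed.

Lemma sin_lip t : `|sin t| <= `|t|.
Proof.
rewrite -[sin t]subr0 -[X in _ - X]sin0 -[leRHS]mul1r.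
by apply: (norm_increment_le (F' := cos)) => s _; split; [exact: is_derive_sin|exact: cos_max].
Qed.

Lemma cos_lip t : `|cos t - 1| <= `|t|.
Proof.
rewrite -[X in _ - X]cos0 -[leRHS]mul1r.
apply: (norm_increment_le (F' := fun s => - sin s)) => s _.
by split; [exact: is_derive_cos|rewrite normrN; exact: sin_max].
Qed.

(** A jump [q] over an arc of order [q ^ 2] violates a Lipschitz bound once [q] is small. The factor
    [2 * t] allows for two axis-parallel moves of length at most [t]. *)
Lemma gap_contra t C (p q : R) : 0 < q -> 0 <= C -> t <= p / 2 * q ^+ 2 ->
  q <= C * (2 * t) -> 2 * q * (C * p + 1) < 1 -> False.
Proof.
move=> q0 C0 tq qC Cpq.
have : q <= C * (p * q ^+ 2) by apply: le_trans qC _; rewrite ler_wpM2l //; lra.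
have -> : C * (p * q ^+ 2) = (C * p * q) * q by ring.
rewrite -{1}[q]mul1r ler_pM2r //; nra.
Qed.

Variables (m : nat) (i0 i1 : 'I_m).
Hypothesis i01 : i0 != i1.
Implicit Types (x y : 'rV[R]_m) (i : 'I_m) (h : 'rV[R]_m -> R).

Lemma pd_mvt i h x t C :
  (forall s, `|s| <= `|t| -> derivable h (x + s *: delta_mx 0 i) (delta_mx 0 i) /\
     `|partial i h (x + s *: delta_mx 0 i)| <= C) ->
  `|h (x + t *: delta_mx 0 i) - h x| <= C * `|t|.
Proof.
move=> H; rewrite -{2}[x]addr0 -(scale0r (delta_mx 0 i)).
apply: (norm_increment_le (F := fun t => h (x + t *: delta_mx 0 i))
  (F' := fun s => partial i h (x + s *: delta_mx 0 i))) => s /H [hd hC].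
by split; [exact: (is_derive_line (derivable_pd hd))|exact: hC].
Qed.

Lemma class_C1_bound (U : set 'rV[R]_m) h x : open U -> U x -> class_C 1 U h ->
  exists C, exists2 r, 0 < r & forall y, (forall j, `|y 0 j - x 0 j| < r) ->
    [/\ U y, derivable h y (delta_mx 0 i0), derivable h y (delta_mx 0 i1),
        `|partial i0 h y| <= C & `|partial i1 h y| <= C].
Proof.
move=> oU Ux [_ hC].
pose C := `|partial i0 h x| + `|partial i1 h x| + 1.
have nU : \forall y \near x, U y by exact: open_nbhs_nbhs.
have np i : \forall y \near x, `|partial i h x - partial i h y| < 1.
  have [_ [pc _]] := hC i.
  exact: ((cvgrPdist_lt _ _).1 (pc x Ux) 1 ltr01).
have [r /= r0 rP] := (nbhs_ballP _ _).1 (filterI nU (filterI (np i0) (np i1))).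
exists C, r => // y xy; have [|Uy [p0 p1]] := rP y.
  by split=> // j k; rewrite [j]ord1 /ball /= distrC.
have lip i : `|partial i h x - partial i h y| < 1 ->
    `|partial i h y| <= `|partial i h x| + 1.
  move: (partial i h x) (partial i h y) => a b ab.
  by rewrite -[b](subKr a) (le_trans (ler_normB _ _)) // lerD2l ltW.
split=> //; try exact: (hC _).1.
  by rewrite (le_trans (lip _ p0)) // lerD2r lerDl normr_ge0.
by rewrite (le_trans (lip _ p1)) // lerD2r lerDr normr_ge0.
Qed.

(** Written as two axis-parallel displacements from a basis vector, so that each one is controlled
    by a single partial derivative. *)
Definition circle_pt t : 'rV[R]_m :=
  delta_mx 0 i0 + (cos t - 1) *: delta_mx 0 i0 + sin t *: delta_mx 0 i1.

Lemma circle_pt0 t : circle_pt t 0 i0 = cos t.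
Proof. by rewrite !mxE !eqxx (negPf i01) /=; ring. Qed.

Lemma circle_pt1 t : circle_pt t 0 i1 = sin t.
Proof. by rewrite !mxE !eqxx [i1 == i0]eq_sym (negPf i01) /=; ring. Qed.

Lemma sqn_circle_pt t : sqn (circle_pt t) = 1.
Proof.
rewrite /sqn (dir_sum i01) ?circle_pt0 ?circle_pt1 ?cos2Dsin2 // => i /negPf i0' /negPf i1'.
by rewrite !mxE i0' i1' /=; ring.
Qed.

Lemma harm_circle k t : harm i0 i1 1 k (circle_pt t) = cos (k%:R * t) /\
  harm i0 i1 (iC R) k (circle_pt t) = - sin (k%:R * t).
Proof.
elim: k => [|k [IH0 IH1]]; first by rewrite !harm0 mul0r cos0 sin0 oppr0.
rewrite !harmS mulr1 iC_sqr harmN circle_pt0 circle_pt1 IH0 IH1 -natr1 mulrDl mul1r.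
by rewrite cosD sinD; split; ring.
Qed.

Lemma freq_ge j : 2 * 4 ^+ j <= (freq j)%:R :> R.
Proof. by rewrite -natrX -natrM ler_nat /freq; clear; lia. Qed.

(** At [t = 0] every mode attains its maximum 1, so the drop from [amp (circle_pt 0)] to
    [cos t * amp (circle_pt t)] is a series of nonnegative terms. Its term [J] alone is at least
    [(1 / 2) ^ J] at [t = pi / freq J], an arc of order [4 ^ - J], whereas a C^1 extension is
    locally Lipschitz. *)
Lemma not_sphere_C1_radial :
  ~ sphere_C1 (cliff_coord [set i0]%SET (@radial_data R m i0 i1)).
Proof.
move=> H1; have [|U [H [oU Ux HC HE]]] := H1 (circle_pt 0).
  exact: sqn_circle_pt.
have [C [r r0 Hr]] := class_C1_bound oU Ux HC.
have c0 : circle_pt 0 = delta_mx 0 i0.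
  by rewrite /circle_pt cos0 sin0 subrr !scale0r !addr0.
pose p : R := pi; have p0 : 0 < p by exact: pi_gt0.
have C0 : 0 <= C.
  have [|_ _ _ + _] := Hr (circle_pt 0); first by move=> j; rewrite subrr normr0.
  exact: le_trans.
(* The first bound keeps the arc within distance [r], the second is the smallness that [gap_contra]
   asks for. *)
pose e := Num.min (r / p) (1 / (C * p + 1)).
have Cp : 0 < C * p + 1 by rewrite ltr_wpDl // mulr_ge0 // ltW.
have e0 : 0 < e by rewrite lt_min !divr_gt0.
have [J] := half_lt e0; rewrite lt_min => /andP[Jr JC].
set q := (1 / 2) ^+ J in Jr JC.
have q0 : 0 < q by exact: half_gt0.
have q1 : q <= 1 by apply: exprn_ile1; lra.
(* Half a period of mode [J], which takes the value -1 there. *)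
pose t := p / (freq J)%:R.
have f0 : 0 < (freq J)%:R :> R.
  by apply: lt_le_trans (freq_ge J); rewrite mulr_gt0 // exprn_gt0.
have t_le : t <= p / 2 * q ^+ 2.
  have q4 : q ^+ 2 * 4 ^+ J = 1.
    rewrite /q -exprM mulnC exprM -exprMn.
    by rewrite [X in X ^+ J](_ : _ = 1) ?expr1n //; field.
  rewrite ler_pdivrMr // -[leLHS]mulr1 -!mulrA ler_pM2l //.
  have := ler_wpM2l (sqr_ge0 q) (freq_ge J); rewrite mulrCA q4; lra.
have q2 : p * q ^+ 2 <= p * q by rewrite ler_pM2l // expr2 ler_piMr // ltW.
have pq : p * q <= p by rewrite ler_piMr // ltW.
have t0 : 0 <= t by rewrite divr_ge0 // ltW.
have tr : t < r by move: Jr; rewrite ltr_pdivlMr //; lra.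
have t2 : t <= p / 2 by lra.
have norm_t : `|t| = t by exact: ger0_norm.
have ct : 0 <= cos t by apply: cos_ge0_pihalf; rewrite t2 andbT; lra.
have cl : `|cos t - 1| <= t by rewrite -{2}norm_t; exact: cos_lip.
have sl : `|sin t| <= t by rewrite -{2}norm_t; exact: sin_lip.
have near0 s : `|s| <= t -> forall j,
    `|(delta_mx 0 i0 + s *: delta_mx 0 i0 : 'rV[R]_m) 0 j - circle_pt 0 0 j| < r.
  move=> st j; rewrite c0 !mxE /= [_ + s * _]addrC addrK.
  by case: eqP => _ /=; rewrite ?mulr1 ?mulr0 ?normr0 // (le_lt_trans st).
have near1 s : `|s| <= t -> forall j,
    `|(delta_mx 0 i0 + (cos t - 1) *: delta_mx 0 i0 + s *: delta_mx 0 i1 : 'rV[R]_m) 0 j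
      - circle_pt 0 0 j| < r.
  move=> st j; rewrite c0 !mxE /= -addrA [_ + (_ + _)]addrC addrK.
  have [->|_] := eqVneq j i0.
    by rewrite (negPf i01) /= mulr0 addr0 mulr1 (le_lt_trans cl).
  rewrite mulr0 add0r.
  by case: eqP => _ /=; rewrite ?mulr1 ?mulr0 ?normr0 // (le_lt_trans st).
(* The corner of the path lies off the sphere in general, so the comparison goes through the
   extension [H]. *)
have D0 : `|H (delta_mx 0 i0 + (cos t - 1) *: delta_mx 0 i0) - H (delta_mx 0 i0)| <=
    C * `|cos t - 1|.
  apply: pd_mvt => s /le_trans/(_ cl)/near0/Hr [_ ? _ ? _]; by split.
have D1 : `|H (circle_pt t) - H (delta_mx 0 i0 + (cos t - 1) *: delta_mx 0 i0)| <= C * `|sin t|.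
  apply: pd_mvt => s /le_trans/(_ sl)/near1/Hr [_ _ ? _ ?]; by split.
have Ut : U (circle_pt t).
  by have [|//] := Hr (circle_pt t); exact: near1.
have HEt s : U (circle_pt s) -> H (circle_pt s) = cos s * amp i0 i1 (circle_pt s).
  move=> Us; rewrite HE //; last exact: sqn_circle_pt.
  by rewrite /cliff_coord radial_data_vector circle_pt0.
have gap : q <= amp i0 i1 (circle_pt 0) - cos t * amp i0 i1 (circle_pt t).
  have m1 s j : mode i0 i1 j (circle_pt s) = cos ((freq j)%:R * s).
    by rewrite modeE ?sqn_circle_pt // (harm_circle _ _).1.
  rewrite /amp -dyadic_sumZ; last by move=> j; exact: mode_norm.
  apply: le_trans (dyadic_sum_gap J _ _ _) => [|j|j|j].
  - rewrite !m1 mulr0 cos0 /t mulrCA mulfV ?mulr1 ?cospi.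
      by rewrite -/q ler_peMr ?(ltW q0) //; lra.
    by rewrite pnatr_eq0 /freq addnS.
  - exact: mode_norm.
  - by rewrite normrM mulr_ile1 ?mode_norm // cos_max.
  - rewrite (m1 0) mulr0 cos0 (le_trans (ler_norm _)) // normrM.
    by rewrite mulr_ile1 ?mode_norm // cos_max.
have qC : q <= C * (2 * t).
  have E0 := HEt 0 Ux; have E1 := HEt t Ut.
  rewrite cos0 mul1r in E0; rewrite -E0 -E1 c0 in gap.
  apply: (le_trans gap); apply: le_trans (ler_norm _) _; rewrite distrC.
  set z := H (_ + _) in D0 D1.
  have -> : C * (2 * t) = C * t + C * t by ring.
  rewrite -(subrKA z) (le_trans (ler_normD _ _)) // lerD //.
    by rewrite (le_trans D1) // ler_wpM2l.
  by rewrite (le_trans D0) // ler_wpM2l.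
apply: (gap_contra q0 C0 t_le qC).
by move: JC; rewrite ltr_pdivlMr.
Qed.

End NotC1.

(** * Compactness of the closed ball *)

Section ClosedBall.
Variables (R : realType) (m : nat).
Implicit Types (x : 'rV[R]_m) (h : 'rV[R]_m -> R) (e : R).

Lemma coord_le_sqn x i : x 0 i ^+ 2 <= sqn x.
Proof. by rewrite /sqn (bigD1 i) //= lerDl sumr_ge0 // => j _; rewrite sqr_ge0. Qed.

Lemma compact_unit_cball : compact (unit_cball R m).
Proof.
apply: (@subclosed_compact _ _ [set x : 'rV[R]_m | forall i, x 0 i \in `[-1, 1]]).
- have -> : unit_cball R m = (@sqn R m) @^-1` [set t | t <= 1] by [].
  by apply: preimage_closed => [x _|]; [exact: continuous_sqn|exact: closed_le].
- have := @rV_compact R m (fun=> `[-1, 1]%classic).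
  by apply => _; apply: segment_compact.
move=> x x1 i; rewrite /= in_itv /= -ler_norml -(@ler_pXn2r _ 2) ?nnegrE //.
by rewrite expr1n real_normK ?num_real // (le_trans (coord_le_sqn x i)).
Qed.

Lemma cball_bounded h : {within unit_cball R m, continuous h} ->
  exists2 M, 0 <= M & forall x, sqn x <= 1 -> `|h x| <= M.
Proof.
move=> hc; have /compact_bounded [M [_ HM]] := continuous_compact hc compact_unit_cball.
exists (`|M| + 1) => [|x x1]; first by rewrite addr_ge0.
by apply: (HM (`|M| + 1)); [rewrite (le_lt_trans (ler_norm M)) // ltrDl|exists x].
Qed.

(** Compactness makes the width [k] uniform: points of the sphere use continuity of [h], interior
    points satisfy [P k] vacuously for small [k]. *)
Lemma cball_near_sphere h e : {within unit_cball R m, continuous h} ->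
  (forall x, sqn x = 1 -> h x = 0) -> 0 < e ->
  exists2 k, 0 < k & forall x, sqn x <= 1 -> 1 - sqn x < k -> `|h x| <= e.
Proof.
move=> /subspace_continuousP hc h0 e0.
have /compact_near_coveringP/near_covering_withinP cov := compact_unit_cball.
pose P (k : R) x := 1 - sqn x < k -> `|h x| <= e.
have loc x : unit_cball R m x ->
    \forall x' \near x & k \near 0^'+, unit_cball R m x' -> P k x'.
  rewrite /unit_cball /= -/(sqn x) le_eqVlt => /orP[/eqP x1|x1].
    have xB : unit_cball R m x by rewrite /unit_cball /= -/(sqn x) x1.
    have hx := (cvgrPdist_le _ _).1 (hc x xB) e e0.
    exists ([set y | unit_cball R m y -> `|h y| <= e], setT) => /=.
      split; last exact: filterT.
      have {}hx : \forall y \near x, unit_cball R m y -> `|h x - h y| <= e by exact: hx.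
      by apply: filterS hx => y H yB; have := H yB; rewrite h0 // sub0r normrN.
    by move=> [y k] /= [H _] yB _; exact: H.
  (* Half the gap to the sphere: nearby points keep [1 - sqn y > g], so the premise of [P k] fails
     for [k < g]. *)
  pose g := (1 - sqn x) / 2; have g0 : 0 < g by rewrite divr_gt0 // subr_gt0.
  exists ([set y | sqn y < 1 - g], [set k | k < g]) => /=.
    split; last exact: nbhs_right_lt.
    apply: (cvgr_lt _ (@continuous_sqn R m x)).
    by rewrite /g; lra.
  by move=> [y k] /= [yg kg] _; rewrite /P => yk; exfalso; lra.
have H : \forall k \near 0^'+, unit_cball R m `<=` P k by exact: cov.
have [k [k0 kP]] := filter_ex (filterI (nbhs_right_gt (0 : R)) H).
by exists k => // x x1; apply: kP.
Qed.

End ClosedBall.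

(** * Pairing a solution with the test field *)

Section Contradiction.
Variables (R : realType) (m : nat) (i0 i1 : 'I_m).
Hypothesis i01 : i0 != i1.
Implicit Types (x : 'rV[R]_m) (i : 'I_m) (d e : R) (l j n : nat).
Local Notation harm := (harm i0 i1).
Local Notation rho := (rho i0 i1).
Local Notation dirC := (dirC R i0 i1).
Local Notation iC := (iC R).
Local Notation amp := (amp i0 i1).

Lemma harm_dirC_le l i x : rho x <= 1 -> `|harm (dirC i) (l + l) x| <= 1.
Proof.
move=> r1; have rl : rho x ^+ l <= 1 by rewrite exprn_ile1 ?rho_ge0.
have [->|j0] := eqVneq i i0.
  by rewrite dirC_i0 // (le_trans (harm1_le _ _ _ _)).
have [->|j1] := eqVneq i i1.
  by rewrite dirC_i1 // (le_trans (harmi_le _ _ _ _)).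
by rewrite dirC0 // harm_c0 normr0.
Qed.

Variable u : 'I_m -> 'rV[R]_m -> R.
Variables (M e k : R).
Hypothesis uM : forall i x, sqn x <= 1 -> `|u i x| <= M.
Hypothesis ue : forall i x, sqn x <= 1 -> 1 - sqn x < k ->
  `|u i x - x 0 i * amp x| <= e.

Lemma field_pairing_le l x : sqn x <= 1 ->
  `|\sum_i u i x * harm (dirC i) (l + l) x| <= 2 * M * rho x ^+ l.
Proof.
move=> x1; rewrite (dir_sum i01) => [|i ? ?]; last by rewrite dirC0 // harm_c0 mulr0.
rewrite dirC_i0 // dirC_i1 // (le_trans (ler_normD _ _)) // -mulrA.
rewrite [2 * _]mulrDl mul1r lerD // normrM ler_pM ?normr_ge0 ?uM //.
  exact: harm1_le.
exact: harmi_le.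
Qed.

(** If [u i] is replaced by [x 0 i * amp x], Euler's identity turns the sum into
    [(2 - 4) * sqn x * P * amp x]. The replacement costs [e] times at most [2 + 4] for each of the
    [m] coordinates. *)
Lemma radial_pairing l x : sqn x <= 1 -> 1 - sqn x < k ->
  \sum_i u i x * (2 * sqn x * harm (dirC i) (l + l) x
                  - 4 * x 0 i * harm 1 (l + l).+1 x) <=
  - 2 * (sqn x * harm 1 (l + l).+1 x) * amp x + 6 * m%:R * e.
Proof.
move=> x1 xk; set P := harm 1 _ x; set q := fun i => harm (dirC i) (l + l) x.
pose v i := 2 * sqn x * q i - 4 * x 0 i * P.
have r1 : rho x <= 1 := le_trans (rho_le i01 x) x1.
have s0 : 0 <= sqn x by rewrite sumr_ge0 // => i _; rewrite sqr_ge0.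
have vle i : `|v i| <= 6.
  have xi : `|x 0 i| <= 1.
    rewrite -(@ler_pXn2r _ 2) ?nnegrE // expr1n real_normK ?num_real //.
    exact: le_trans (coord_le_sqn x i) x1.
  have qi : `|sqn x * q i| <= 1.
    by rewrite normrM mulr_ile1 ?harm_dirC_le // ger0_norm.
  have Pi : `|x 0 i * P| <= 1 by rewrite normrM mulr_ile1 ?harm1_le1.
  rewrite /v -!mulrA; move: qi Pi; move: (_ * q i) (x 0 i * P) => a b.
  rewrite !ler_norml; lra.
have E : \sum_i u i x * v i =
    amp x * \sum_i x 0 i * v i + \sum_i (u i x - x 0 i * amp x) * v i.
  by rewrite mulr_sumr -big_split; apply: eq_bigr => i _ /=; ring.
have E' : \sum_i x 0 i * v i = - 2 * (sqn x * P).
  transitivity (2 * sqn x * (\sum_i x 0 i * q i) - 4 * P * sqn x).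
    rewrite mulr_sumr [X in _ - _ * X]/sqn [X in _ - X]mulr_sumr -sumrB; apply: eq_bigr => i _.
    by rewrite /v; ring.
  have -> : \sum_i x 0 i * q i = P.
    rewrite -[P](harm_euler i01); apply: eq_bigr => i _; by rewrite mulr1.
  by ring.
rewrite -/(v _) [leLHS]E E' [amp x * _]mulrC lerD2l.
apply: le_trans (ler_norm _) _; apply: le_trans (ler_norm_sum _ _ _) _.
have -> : 6 * m%:R * e = \sum_(i < m) e * 6.
  by rewrite sumr_const card_ord -mulr_natl; ring.
by apply: ler_sum => i _; rewrite normrM ler_pM // ue.
Qed.

End Contradiction.

(** * Nonexistence of a solution *)

Section Nonexistence.
Variables (R : realType) (m : nat) (i0 i1 : 'I_m).
Hypothesis i01 : i0 != i1.
Hypothesis m_ge3 : (3 <= m)%N.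
Implicit Types (x : 'rV[R]_m) (i : 'I_m) (d e k M : R) (l j n J : nat).
Local Notation harm := (harm i0 i1).
Local Notation rho := (rho i0 i1).
Local Notation dirC := (dirC R i0 i1).
Local Notation amp := (amp i0 i1).

Let h j : R := (1 / 2) ^+ j.

Definition moment l d x := rho x ^+ l * eta1 d (1 - sqn x).

(** Null means add up over finite sums only; the tail of the series becomes an error [4 * h n] times
    the mass of [eta2]. *)
Definition partial_amp n x := \sum_(j < n) h j * harm 1 (freq j) x.

Lemma partial_amp_close n x : sqn x <= 1 -> `|amp x - partial_amp n x| <= 2 * h n.
Proof.
move=> x1; have := dyadic_tail n (fun j => mode_norm i0 i1 j x).
rewrite /series /= big_mkord; congr (`|_ - _| <= _).
by apply: eq_bigr => j _; rewrite /dyadic_term modeE.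
Qed.

(** Orthogonality leaves mode [J] only, and its coefficient [h J] comes out multiplied by
    [m + 2 * freq J]. *)
Lemma asym_null_partial_amp n J d : 0 < d -> (J < n)%N ->
  asym_null (fun x => 2 * sqn x * (harm 1 (freq J) x * partial_amp n x)
      * eta2 d (1 - sqn x)
    - h J * (m + 2 * freq J)%:R / 2 * moment (freq J) d x).
Proof.
move=> d0 Jn; pose o := Ordinal Jn.
pose F (j : 'I_n) x := 2 * sqn x * (harm 1 (freq J) x * harm 1 (freq j) x)
  * eta2 d (1 - sqn x) - (j == o)%:R * ((m + 2 * freq J)%:R / 2 * moment (freq J) d x).
have N (j : 'I_n) : asym_null (F j).
  have [->|jo] := eqVneq j o.
    apply: asym_null_ext (asym_null_eta2_sqr i01 d0 (_ : (0 < freq J)%N)) => [x _|].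
      by rewrite /F eqxx mul1r.
    by rewrite /freq addnS.
  have JF : freq J != freq j.
    rewrite /freq; apply: contra_neq jo => E; apply: val_inj => /=.
    by apply/eqP; rewrite -(@eqn_exp2l 4) //; apply/eqP; lia.
  apply: asym_null_ext (asym_null_eta2_orth i01 d0 JF) => x _.
  by rewrite /F (negPf jo) mul0r subr0.
have S := asym_null_sum (index_enum _) (P := xpredT) (fun (j : 'I_n) _ => asym_nullZ (h j) (N j)).
apply: asym_null_ext S => x _ /=.
under eq_bigr => j _ do rewrite /F mulrBr.
rewrite sumrB; congr (_ - _).
  rewrite /partial_amp !mulr_sumr mulr_suml; apply: eq_bigr => j _; ring.
rewrite (bigD1 o) //= big1 => [|j /negPf ->]; last by rewrite mul0r mulr0.
by rewrite eqxx mul1r addr0 !mulrA.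
Qed.

(** On the window [sqn x <= 1 / m <= 1 / 3], so [eta1] is 1 there as soon as [6 * d <= 1]. The
    constant precedes [d], which can then be taken small against it. *)
Lemma moment_window l : exists2 c, 0 < c & forall d N, 0 < d -> 6 * d <= 1 ->
  c <= grid_mean N (moment l d).
Proof.
have m0 : (0 < m)%N by exact: leq_trans m_ge3.
have mR : 3 <= m%:R :> R by rewrite ler_nat.
pose w : R := (2 * m)%:R^-1 ^+ 2.
have w0 : 0 < w by rewrite exprn_gt0 // invr_gt0 ltr0n muln_gt0.
exists (w ^+ l / (4 * m)%:R ^+ m).
  by apply: divr_gt0; rewrite exprn_gt0 // ltr0n muln_gt0.
move=> d N d0 d6; apply: grid_mean_window => // [x _||x xw].
- by rewrite mulr_ge0 ?exprn_ge0 ?rho_ge0 //; case/andP: (eta1_itv (1 - sqn x) d0).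
- by rewrite exprn_ge0 // ltW.
have x0 i : 0 <= x 0 i by case/andP: (xw i) => + _; apply: le_trans; rewrite invr_ge0 ler0n.
have sq : sqn x <= m%:R^-1.
  have -> : m%:R^-1 = \sum_(i < m) (m%:R^-1 ^+ 2) :> R.
    by rewrite sumr_const card_ord -[RHS]mulr_natl expr2 mulrA mulfV ?mul1r // gt_eqF; lra.
  by apply: ler_sum => i _; rewrite lerXn2r ?nnegrE ?invr_ge0 //; case/andP: (xw i).
have m3 : m%:R^-1 <= 1 / 3 :> R by rewrite mul1r lef_pV2 ?posrE //; lra.
rewrite /moment eta1_ge //; last by lra.
rewrite mulr1 lerXn2r ?nnegrE ?rho_ge0 ?(ltW w0) //.
rewrite (@le_trans _ _ (x 0 i0 ^+ 2)) ?lerDl ?sqr_ge0 //.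
by rewrite lerXn2r ?nnegrE ?invr_ge0 //; case/andP: (xw i0).
Qed.

Variable f : 'rV[R]_m -> clifford R m.
Hypothesis fC2 : cliff_class_C 2 (unit_ball R m) f.
Hypothesis f_cont : cliff_continuous_on (unit_cball R m) f.
Hypothesis f_eq : forall x, unit_ball R m x -> diracl (diracr f) x = 0.
Hypothesis f_bd : forall x, unit_sphere R m x -> f x = radial_data i0 i1 x.

Lemma f_bounded : exists2 M, 0 <= M &
  forall i x, sqn x <= 1 -> `|f x [set i]%SET| <= M.
Proof.
have H i : exists2 M, 0 <= M & forall x, sqn x <= 1 -> `|f x [set i]%SET| <= M.
  have [M M0 MP] := cball_bounded (@f_cont [set i]%SET).
  by exists M => // x; exact: MP.
have H' i : exists M, 0 <= M /\ forall x, sqn x <= 1 -> `|f x [set i]%SET| <= M.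
  by have [M M0 MP] := H i; exists M.
have [M MP] := choice H'.
exists (\sum_i M i) => [|i x x1]; first by apply: sumr_ge0 => i _; exact: (MP i).1.
apply: le_trans ((MP i).2 x x1) _.
by rewrite (bigD1 i) //= lerDl sumr_ge0 // => j _; exact: (MP j).1.
Qed.

Lemma f_near_sphere e : 0 < e -> exists2 k, 0 < k &
  forall i x, sqn x <= 1 -> 1 - sqn x < k -> `|f x [set i]%SET - x 0 i * amp x| <= e.
Proof.
move=> e0.
have H i : exists k, 0 < k /\ forall x, sqn x <= 1 -> 1 - sqn x < k ->
    `|f x [set i]%SET - x 0 i * amp x| <= e.
  pose g x := x 0 i * amp x.
  have gc : {within unit_cball R m, continuous g}.
    apply: continuous_subspaceT; apply: continuous_mulf.
      exact: coord_continuous.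
    exact: continuous_amp.
  have [|x x1|k k0 kP] := @cball_near_sphere _ _ (cliff_coord [set i]%SET f - g) e _ _ e0.
  - by move=> x; exact: (continuousB (@f_cont [set i]%SET x) (gc x)).
  - rewrite !fctE /cliff_coord f_bd // radial_data_vector; exact: subrr.
  - by exists k.
have [k kP] := choice H.
exists (\big[Num.min/1]_i k i).
  by apply: lt_bigmin => // i _; exact: (kP i).1.
move=> i x x1 xk; apply: (kP i).2 => //; apply: lt_le_trans xk _.
exact: bigmin_le_cond.
Qed.

(** The part with [eta1] is bounded through [M]. The part with [eta2] lives in a shell where [f] is
    close to its boundary values, and there [radial_pairing] cancels the first term up to the tail
    of [amp]. *)
Lemma pointwise_estimate M e k d l n x :
  (forall i x, sqn x <= 1 -> `|f x [set i]%SET| <= M) ->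
  (forall i x, sqn x <= 1 -> 1 - sqn x < k ->
     `|f x [set i]%SET - x 0 i * amp x| <= e) ->
  0 < d -> 3 * d <= k -> 
  2 * sqn x * (harm 1 (l + l).+1 x * partial_amp n x) * eta2 d (1 - sqn x)
  + \sum_i f x [set i]%SET *
      ((2 - m%:R) * harm (dirC i) (l + l) x * eta1 d (1 - sqn x)
       + (2 * sqn x * harm (dirC i) (l + l) x - 4 * x 0 i * harm 1 (l + l).+1 x)
         * eta2 d (1 - sqn x))
  <= (m%:R - 2) * (2 * M) * moment l d x
     + (6 * m%:R * e + 4 * h n) * eta2 d (1 - sqn x).
Proof.
move=> fM fe d0 dk; have mR : 3 <= m%:R :> R by rewrite ler_nat.
rewrite /moment; set E1 := eta1 d _; set E2 := eta2 d _.
(* All weights vanish here, which covers the points outside the ball, where [f] is arbitrary. *)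
have [sd|sd] := leP (1 - sqn x) d.
  rewrite /E1 /E2 eta1_le ?eta2_le ?(ltW d0) // !mulr0 !add0r big1 // => i _.
  by rewrite !mulr0 addr0 mulr0.
have x1 : sqn x <= 1 by lra.
have [E10 E11] := andP (eta1_itv (1 - sqn x) d0); rewrite -/E1 in E10 E11.
have E20 := eta2_ge0 (1 - sqn x) d0; rewrite -/E2 in E20.
pose u i x := f x [set i]%SET.
set P := harm 1 _ x; pose q i := harm (dirC i) (l + l) x.
have -> : \sum_i f x [set i]%SET * ((2 - m%:R) * harm (dirC i) (l + l) x * E1
       + (2 * sqn x * harm (dirC i) (l + l) x - 4 * x 0 i * P) * E2) =
    (2 - m%:R) * E1 * (\sum_i u i x * q i)
    + E2 * \sum_i u i x * (2 * sqn x * q i - 4 * x 0 i * P).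
  rewrite !mulr_sumr -big_split; apply: eq_bigr => i _ /=.
  by rewrite /u /q; ring.
have A := @field_pairing_le _ _ _ _ i01 u M fM l x x1.
have A' : (2 - m%:R) * E1 * (\sum_i u i x * q i) <=
    (m%:R - 2) * (2 * M) * (rho x ^+ l * E1).
  move: A; rewrite -/(q _) ler_norml; move: (\sum_i _) (rho x ^+ l) => s r /andP[s0 _].
  have : 0 <= (m%:R - 2) * E1 * (2 * M * r + s).
    by apply: mulr_ge0; [apply: mulr_ge0; lra|lra].
  lra.
suff B : 2 * sqn x * (P * partial_amp n x) * E2
    + E2 * \sum_i u i x * (2 * sqn x * q i - 4 * x 0 i * P) <=
    (6 * m%:R * e + 4 * h n) * E2 by lra.
have [s3|s3] := leP (3 * d) (1 - sqn x).
  by rewrite /E2 eta2_ge // !(mulr0, mul0r) addr0.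
have C := @radial_pairing _ _ _ _ i01 u e k fe l x x1 (lt_le_trans s3 dk).
have D := partial_amp_close n x1.
have P1 : `|sqn x * P| <= 1.
  rewrite normrM mulr_ile1 ?harm1_le1 ?(le_trans (rho_le i01 x)) //.
  by rewrite ger0_norm // sumr_ge0 // => i _; rewrite sqr_ge0.
have PD : `|(sqn x * P) * (amp x - partial_amp n x)| <= 2 * h n.
  by rewrite normrM -[leRHS]mul1r ler_pM.
rewrite -/P in C; rewrite [_ * E2]mulrC -mulrDr [leRHS]mulrC ler_wpM2l //.
move: C PD; rewrite -/(q _) ler_norml => C /andP[PD _].
rewrite (le_trans (lerD (lexx _) C)) //.
move: (amp x) (partial_amp n x) (h n) (sqn x) PD => a b c s PD.
lra.
Qed.

Lemma amplitude_large (b : R) : exists J,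
  b <= h J * (m + 2 * freq J)%:R / 2 * (expR (m%:R / 2))^-1.
Proof.
set c := (expR _)^-1; have c0 : 0 < c by rewrite invr_gt0 expR_gt0.
have bc : 0 < c / (`|b| + 1) by rewrite divr_gt0 // ltr_wpDl.
have [J] := half_lt bc; rewrite ltr_pdivlMr ?ltr_wpDl // => Jb; exists J.
have h0 : 0 < h J := half_gt0 R J.
have hJ : h J * (h J * 4 ^+ J) = 1.
  by rewrite /h mulrA -!exprMn [X in X ^+ J](_ : _ = 1) ?expr1n //; field.
have F : 4 * 4 ^+ J <= (m + 2 * freq J)%:R :> R.
  rewrite natrD natrM (le_trans _ (_ : 2 * (freq J)%:R <= _)) ?lerDr ?ler0n //.
  have := @freq_ge R J; lra.
have HF : 2 * (h J * 4 ^+ J) <= h J * (m + 2 * freq J)%:R / 2.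
  have := ler_wpM2l (ltW h0) F.
  by move: (h J) (4 ^+ J) ((m + 2 * freq J)%:R) => a q r ?; lra.
apply: le_trans (ler_wpM2r (ltW c0) HF).
rewrite -(ler_pM2l h0).
have -> : h J * (2 * (h J * 4 ^+ J) * c) = 2 * (h J * (h J * 4 ^+ J)) * c by ring.
rewrite hJ; have hb : h J * b <= h J * (`|b| + 1).
  by rewrite ler_pM2l // ler_wpDr // ler_norm.
move: Jb hb h0; rewrite -/(h J); move: (h J) => a; lra.
Qed.

(** Here [X] and [Y] stand for the moments of degrees [l] and [2 l + 1], [S] for the pairing with
    [partial_amp], [V] for the tested equation and [E] for [eta2]. [Y] cancels, and [B + 1 <= A * c]
    leaves one spare [X]. *)
Lemma moment_combine (A B c t K q X Y S V E : R) :
  S + V <= B * X + K * E -> B + 1 <= A * c -> 0 <= X ->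
  X - (A * t + K * q) <=
  A * (c * X - Y - t) + - (S - A * Y) + (- V + K * (E - q)).
Proof.
move=> SV BA X0; have := ler_wpM2r X0 BA; lra.
Qed.

(** The order of the choices matters: [M] from [f], [J] from [M], the lower bound [w] from [J], and
    only then [e], [k], [n] and [d], small against [w]. *)
Lemma radial_data_unsolvable : False.
Proof.
have mR : 3 <= m%:R :> R by rewrite ler_nat.
have [M M0 fM] := f_bounded.
pose B := (m%:R - 2) * (2 * M).
have [J JB] := amplitude_large (B + 1).
set c := (expR _)^-1 in JB; set A := h J * _ / 2 in JB.
pose l := (4 ^ J)%N; have [w w0 wP] := moment_window l.
have A0 : 0 <= A by rewrite divr_ge0 ?mulr_ge0 ?ler0n // ltW // half_gt0.
(* The constants 48, 16 and 24 make each of the three terms of [C] below at most [w / 8]. *)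
pose e := w / (48 * m%:R ^+ 2).
have m0 : 0 < m%:R :> R by lra.
have e0 : 0 < e by rewrite divr_gt0 // mulr_gt0 // exprn_gt0.
have [k k0 fe] := f_near_sphere e0.
have w16 : 0 < w / (16 * m%:R) by rewrite divr_gt0 // mulr_gt0.
(* Adding [J.+1] ensures that mode [J] belongs to the truncation. *)
have [n0 n0P] := half_lt w16; pose n := (n0 + J.+1)%N.
have nP : 2 * h n < w / (16 * m%:R).
  apply: le_lt_trans n0P; rewrite ler_pM2l // /h exprD ler_piMr ?(ltW (half_gt0 R n0)) //.
  by apply: exprn_ile1; lra.
have Jn : (J < n)%N by rewrite leq_addl.
pose D := 24 * (A * l.+1%:R + 1).
have D0 : 0 < D by rewrite mulr_gt0 // ltr_wpDl // mulr_ge0.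
pose d := Num.min (Num.min (1 / 6) (k / 3)) (w / D).
have d0 : 0 < d by rewrite !lt_min !divr_gt0.
have d6 : 6 * d <= 1.
  have : d <= 1 / 6 by rewrite !ge_min lexx.
  lra.
have dk : 3 * d <= k.
  have : d <= k / 3 by rewrite !ge_min lexx orbT.
  lra.
have dD : d * D <= w by rewrite -ler_pdivlMr // /d !ge_min lexx !orbT.
pose K := 6 * m%:R * e + 4 * h n.
have K0 : 0 <= K by rewrite addr_ge0 ?mulr_ge0 // ltW // half_gt0.
have N1 := asym_npos_rho_double i01 l d0.
have [N2 _] := asym_nullN (asym_null_partial_amp d0 Jn).
have [_ N3] := asym_null_field i01 (l + l) d0 fC2 f_eq.
have N4 := asym_npos_eta2 i01 d0 d6.
have N := asym_nposD (asym_nposD (asym_nposZ A0 N1) N2)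
  (asym_nposD N3 (asym_nposZ K0 N4)).
pose C := A * (l.+1%:R * (3 * d)) + K * m%:R.
have X0 : asym_npos (fun x => moment l d x - C).
  apply: asym_npos_le N => x _; rewrite /= !fctE /=.
  have := pointwise_estimate l n x fM fe d0 dk; rewrite -addnS -/(freq J) => PE.
  apply: moment_combine PE JB _; rewrite mulr_ge0 ?exprn_ge0 ?rho_ge0 //.
  by case/andP: (eta1_itv (1 - sqn x) d0).
have CW : C <= w / 2.
  have Ke : 6 * m%:R * e * m%:R = w / 8 by rewrite /e; field; rewrite gt_eqF.
  have Kh : 2 * h n * m%:R <= w / 16.
    rewrite -ler_pdivlMr // (le_trans (ltW nP)) // le_eqVlt; apply/orP; left.
    by apply/eqP; field; rewrite gt_eqF.
  have -> : C = 3 * (A * l.+1%:R * d) + 6 * m%:R * e * m%:R + 2 * (2 * h n * m%:R).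
    by rewrite /C /K; ring.
  rewrite Ke; move: dD; rewrite /D.
  move: Kh; move: (h n) (l.+1%:R) => a r; lra.
(* A single grid suffices: the mean of [moment l d] minus [C] is at most [w / 4], yet at least
   [w - w / 2]. *)
have /X0 : 0 < w / 4 by rewrite divr_gt0.
move=> /filter_ex [N'].
have -> : (fun x => moment l d x - C) = moment l d + (fun=> - C) by [].
rewrite grid_meanD grid_mean_cst ?(leq_trans _ m_ge3) //.
have := wP d N' d0 d6; lra.
Qed.

End Nonexistence.

Theorem mainTheorem3 (R : realType) (m : nat) (m_ge3 : (3 <= m)%N)
    (m_odd : odd m) :
  exists g : 'rV[R]_m -> clifford R m,
    [/\ cliff_continuous_on (unit_sphere R m) g,
        ~ cliff_sphere_C1 g &
        ~ (exists f : 'rV[R]_m -> clifford R m,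
             [/\ cliff_class_C 2 (unit_ball R m) f,
                 cliff_continuous_on (unit_cball R m) f,
                 (forall x, unit_ball R m x -> diracl (diracr f) x = 0) &
                 (forall x, unit_sphere R m x -> f x = g x)])].
Proof.
pose i0 : 'I_m := Ordinal (leq_trans (isT : 0 < 3)%N m_ge3).
pose i1 : 'I_m := Ordinal (leq_trans (isT : 1 < 3)%N m_ge3).
have i01 : i0 != i1 by [].
exists (radial_data i0 i1); split.
- by move=> A; apply: continuous_subspaceT; exact: continuous_radial_data.
- by move=> /(_ [set i0]%SET); exact: not_sphere_C1_radial.
- move=> [f [fC2 f_cont f_eq f_bd]].
  exact: (radial_data_unsolvable i01 m_ge3 fC2 f_cont f_eq f_bd).
Qed.
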